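(* Let $G$ be an indecomposable closed graph whose clique complex $\Delta(G)=\langle F_1,F_2\rangle$ has exactly two facets. Then $J_G$ is sequentially Cohen-Macaulay.
   Context: Graphs are simple. For a graph $G$ on $[n]=\{1,\ldots,n\}$ and a field $K$, let $S=K[x_1,\ldots,x_n,y_1,\ldots,y_n]$. The binomial edge ideal $J_G\subset S$ is generated by all $x_iy_j-x_jy_i$ with $i<j$ and $\{i,j\}\in E(G)$. The clique complex $\Delta(G)$ is the simplicial complex whose faces are the vertex sets of complete induced subgraphs of $G$; $\Delta(G)=\langle F_1,\ldots,F_r\rangle$ means that $F_1,\ldots,F_r$ are all its facets (the maximal cliques). Integer intervals are $[a,b]=\{m\in\mathbb{Z}: a\le m\le b\}$. $G$ is closed if (with respect to a suitable labeling of the vertices, which is always fixed) the facets of $\Delta(G)$ are intervals $F_i=[a_i,b_i]$ which can be ordered such that $1=a_1<\cdots<a_r<b_r=n$. A vertex is free if it belongs to exactly one maximal clique. A connected graph $G$ is decomposable if there are subgraphs $G_1,G_2$ of $G$, each with at least two vertices, such that $G=G_1\cup G_2$ and $V(G_1)\cap V(G_2)=\{v\}$, where $v$ is a free vertex of both $G_1$ and $G_2$. A connected graph that is not decomposable is indecomposable. A finitely generated graded module $M$ over a standard graded polynomial ring over $K$ is sequentially Cohen-Macaulay if there is a finite filtration by graded submodules $0=M_0\subset M_1\subset\cdots\subset M_t=M$ such that each $M_i/M_{i-1}$ is Cohen-Macaulay and $\dim(M_1/M_0)<\dim(M_2/M_1)<\cdots<\dim(M_t/M_{t-1})$. The ideal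 $J_G$ is called sequentially Cohen-Macaulay if $S/J_G$ is. *)

(* Defs.v *)
From HB Require Import structures.
From mathcomp Require Import all_boot perm all_algebra.
From mathcomp.multinomials Require Import mpoly.

Set Implicit Arguments.
Unset Strict Implicit.
Unset Printing Implicit Defensive.

Import GRing.Theory.
Local Open Scope ring_scope.

(* Simple graphs whose vertex set is a subset of a finite type, so that a graph
   and its subgraphs have the same type. *)
Record sgraph (T : finType) := SGraph {
  vset : {set T};
  adj : rel T;
  adj_sym : ssrbool.symmetric adj;
  adj_irr : irreflexive adj;
  adj_vset : forall x y, adj x y -> x \in vset }.

Definition clique (T : finType) (G : sgraph T) (F : {set T}) : bool :=
  (F \subset vset G) &&
  [forall x in F, forall y in F, (x != y) ==> adj G x y].

Definition facets (T : finType) (G : sgraph T) : {set {set T}} :=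
  [set F | maxset (clique G) F].

Definition free_vertex (T : finType) (G : sgraph T) (v : T) : Prop :=
  #|[set F in facets G | v \in F]| = 1%N.

Definition connected_graph (T : finType) (G : sgraph T) : Prop :=
  forall x y, x \in vset G -> y \in vset G -> connect (adj G) x y.

Definition decomposable (T : finType) (G : sgraph T) : Prop :=
  connected_graph G /\
  exists (G1 G2 : sgraph T) (v : T),
    [/\ (1 < #|vset G1|)%N /\ (1 < #|vset G2|)%N,
        vset G = vset G1 :|: vset G2,
        forall x y, adj G x y = adj G1 x y || adj G2 x y,
        vset G1 :&: vset G2 = [set v]
      & free_vertex G1 v /\ free_vertex G2 v].

Definition indecomposable (T : finType) (G : sgraph T) : Prop :=
  connected_graph G /\ ~ decomposable G.

(* The labeling is [s], with labels 0, ..., n-1 in place of 1, ..., n.  The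
   facets are the intervals [a i, b i] for i = 0, ..., r. *)
Definition closed_graph (n : nat) (G : sgraph 'I_n) : Prop :=
  exists (s : {perm 'I_n}) (r : nat) (a b : 'I_r.+1 -> nat),
    [/\ facets G = [set [set v | (a i <= s v <= b i)%N] | i : 'I_r.+1],
        a ord0 = 0%N,
        forall i j : 'I_r.+1, (i < j)%N -> (a i < a j)%N,
        (a ord_max < b ord_max)%N
      & (b ord_max).+1 = n].

(* The variables x_i are the first n of the 2n variables, the y_i the last n. *)
Definition xvar (K : fieldType) (n : nat) (i : 'I_n) : {mpoly K[n + n]} :=
  'X_(lshift n i).

Definition yvar (K : fieldType) (n : nat) (i : 'I_n) : {mpoly K[n + n]} :=
  'X_(rshift n i).

Definition binomial_edge_ideal (K : fieldType) (n : nat) (G : sgraph 'I_n)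
    (f : {mpoly K[n + n]}) : Prop :=
  exists c : 'I_n -> 'I_n -> {mpoly K[n + n]},
    f = \sum_(i < n) \sum_(j < n | (i < j)%N && adj G i j)
          c i j * (xvar K i * yvar K j - xvar K j * yvar K i).

Definition submodule (R : comNzRingType) (A : lmodType R) (N : A -> Prop)
    : Prop :=
  [/\ N 0, forall x y, N x -> N y -> N (x + y)
    & forall (a : R) x, N x -> N (a *: x)].

Definition prime_ideal (R : comNzRingType) (P : R -> Prop) : Prop :=
  [/\ @submodule R R^o P, ~ P 1 & forall a b, P (a * b) -> P a \/ P b].

Definition prime_chain (R : comNzRingType) (I : R -> Prop) (d : nat) : Prop :=
  exists P : nat -> R -> Prop,
    (forall i, (i <= d)%N -> prime_ideal (P i) /\ (forall a, I a -> P i a)) /\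
    (forall i, (i < d)%N ->
       (forall a, P i a -> P i.+1 a) /\ (exists a, P i.+1 a /\ ~ P i a)).

(* Below, two submodules N <= L of an ambient module A stand for the module
   L/N. *)

Definition annihilator (R : comNzRingType) (A : lmodType R) (L N : A -> Prop)
    (a : R) : Prop :=
  forall x, L x -> N (a *: x).

(* Krull dimension of L/N, that is, of R/Ann(L/N).  It is a relation because
   the dimension may be infinite, and L/N = 0 has no dimension here. *)
Definition has_dim (R : comNzRingType) (A : lmodType R) (L N : A -> Prop)
    (d : nat) : Prop :=
  prime_chain (annihilator L N) d /\
  (forall e, prime_chain (annihilator L N) e -> (e <= d)%N).

(* The submodule (s_0, ..., s_(k-1)) L + N. *)
Definition seq_mul_add (R : comNzRingType) (A : lmodType R) (s : seq R)
    (L N : A -> Prop) (x : A) : Prop :=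
  exists (c : nat -> A) (y : A),
    [/\ forall i, L (c i), N y & x = \sum_(i < size s) s`_i *: c i + y].

Definition regular_sequence (R : comNzRingType) (A : lmodType R)
    (L N : A -> Prop) (s : seq R) : Prop :=
  (forall i, (i < size s)%N -> forall x, L x ->
     seq_mul_add (take i s) L N (s`_i *: x) -> seq_mul_add (take i s) L N x) /\
  (exists x, L x /\ ~ seq_mul_add s L N x).

Definition has_depth (R : comNzRingType) (m : R -> Prop) (A : lmodType R)
    (L N : A -> Prop) (d : nat) : Prop :=
  (exists s : seq R,
     [/\ size s = d, forall a, a \in s -> m a & regular_sequence L N s]) /\
  (forall s : seq R,
     (forall a, a \in s -> m a) -> regular_sequence L N s -> (size s <= d)%N).

Definition irrelevant_ideal (K : fieldType) (k : nat) (f : {mpoly K[k]})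
    : Prop :=
  f@_0%MM = 0.

Definition graded_ideal (K : fieldType) (k : nat) (I : {mpoly K[k]} -> Prop)
    : Prop :=
  @submodule {mpoly K[k]} {mpoly K[k]}^o I /\
  (forall (d : nat) f, I f -> I (pihomog mdeg d f)).

(* L/N is Cohen-Macaulay of dimension d, for graded ideals N <= L: for graded
   modules the depth is taken with respect to the graded maximal ideal.  The
   zero module is excluded. *)
Definition cohen_macaulay_of_dim (K : fieldType) (k : nat)
    (L N : {mpoly K[k]} -> Prop) (d : nat) : Prop :=
  @has_dim {mpoly K[k]} {mpoly K[k]}^o L N d /\
  @has_depth {mpoly K[k]} (@irrelevant_ideal K k) {mpoly K[k]}^o L N d.

(* S/J is sequentially Cohen-Macaulay.  The graded submodules of S/J are the
   M i / J for graded ideals M i containing J, and the factors of the filtration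
   are the M i.+1 / M i. *)
Definition sequentially_cohen_macaulay (K : fieldType) (k : nat)
    (J : {mpoly K[k]} -> Prop) : Prop :=
  exists (t : nat) (M : nat -> {mpoly K[k]} -> Prop) (d : nat -> nat),
    [/\ (forall f, M 0%N f <-> J f) /\ (forall f, M t f),
        forall i, (i <= t)%N -> graded_ideal (M i),
        forall i, (i < t)%N -> forall f, M i f -> M i.+1 f,
        forall i, (i < t)%N -> cohen_macaulay_of_dim (M i.+1) (M i) (d i)
      & forall i, (i.+1 < t)%N -> (d i < d i.+1)%N].

(* Main.v *)
From HB Require Import structures.
Require Import Defs.
From mathcomp Require Import all_boot perm all_algebra.
From mathcomp.multinomials Require Import mpoly.
From mathcomp Require Import ring zify.

(* Let [C] be the intersection of the two facets, [A] and [B] the rest of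
   the first and of the second one, [p = #|A|], [q = #|B|].
   Indecomposability gives [#|C| >= 2]. The filtration is [J_G <= J_Kn <=
   S], with factors of dimensions [p + q + 2 < n + 1].

   Write [x_i = t_i], [y_i = w t_i] with [t_0 = T_0], [t_(i+1) = T_(i+1) + w
   t_i]. This sends [S] to a polynomial ring in [n + 1] variables, with
   kernel [J_Kn], and the elements [x_0], [x_(i+1) - y_i], [y_(n-1)] to
   [T_0], [T_(i+1)] and [F = w t_(n-1)]. [S/J_Kn] is free over the
   polynomial ring in these elements with basis [1, y_0, ..., y_(n-2)]: the
   images of the basis and [F] have degrees [0, ..., n-1] and [n] in [w]. In
   the same way, with one [w] for [A], another one for [B], and [C] sent to
   [0], the module [J_Kn/J_G] is free over a polynomial ring in [p + q + 2]
   variables, with basis the minors [[a b]] for [a] in [A] and [b] in [B].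
   Freeness gives a regular sequence; setting the variables to zero one by
   one gives a chain of primes.

   That neither a regular sequence nor a chain of primes can be longer than
   the number [D] of variables is seen by counting: length [d] yields at
   least [binomial (m + d) d] linearly independent elements of degree
   [O(m)], against at most [O(m ^ D)] in the polynomial ring. *)

Set Implicit Arguments.
Unset Strict Implicit.
Unset Printing Implicit Defensive.

Import GRing.Theory.
Local Open Scope ring_scope.

(** * Ideals and quotients by sequences *)

Definition ideal (R : comNzRingType) (N : R -> Prop) : Prop :=
  @submodule R R^o N.

Section Ideals.
Context (R : comNzRingType) (N : R -> Prop) (idN : ideal N).

Lemma ideal0 : N 0. Proof. by case: idN. Qed.

Lemma idealD x y : N x -> N y -> N (x + y). Proof. by case: idN => _ + _; apply. Qed.

Lemma ideal_mull a x : N x -> N (a * x). Proof. by case: idN => _ _; apply. Qed.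

Lemma ideal_mulr a x : N x -> N (x * a).
Proof. by rewrite mulrC; apply: ideal_mull. Qed.

Lemma idealN x : N x -> N (- x). Proof. by rewrite -mulN1r; apply: ideal_mull. Qed.

Lemma idealB x y : N x -> N y -> N (x - y).
Proof. by move=> Nx /idealN; apply: idealD. Qed.

Lemma ideal_sum I (r : seq I) (P : pred I) (F : I -> R) :
  (forall i, P i -> N (F i)) -> N (\sum_(i <- r | P i) F i).
Proof. by move=> NF; apply: big_ind => //; [exact: ideal0 | exact: idealD]. Qed.

Lemma idealBl x y : N (x - y) -> N y -> N x.
Proof. by move=> Nxy Ny; rewrite -(subrK y x); apply: idealD. Qed.

End Ideals.

Section SeqMulAdd.
Context (R : comNzRingType) (L N : R -> Prop) (idL : ideal L) (idN : ideal N).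

Local Notation sma s := (@seq_mul_add R R^o s L N).

Lemma seq_mul_addE s x :
  sma s x <-> exists (c : nat -> R) (y : R),
    [/\ forall i, L (c i), N y & x = \sum_(i < size s) s`_i * c i + y].
Proof. by []. Qed.

Lemma ideal_seq_mul_add s : ideal (sma s).
Proof.
split.
- exists (fun=> 0), 0; split=> [_||]; [exact: ideal0 | exact: ideal0 |].
  by rewrite big1 ?addr0 // => i _; rewrite scaler0.
- move=> x y [c [z [Lc Nz ->]]] [c' [z' [Lc' Nz' ->]]].
  exists (fun i => c i + c' i), (z + z'); split=> [i||].
  + exact: (idealD idL).
  + exact: (idealD idN).
  + rewrite addrACA -big_split /=; congr (_ + _).
    by apply: eq_bigr => i _; rewrite scalerDr.
- move=> a x [c [z [Lc Nz ->]]].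
  exists (fun i => a * c i), (a * z); split=> [i||].
  + exact: (ideal_mull idL).
  + exact: (ideal_mull idN).
  + rewrite scalerDr scaler_sumr; congr (_ + _); apply: eq_bigr => i _.
    exact: mulrCA.
Qed.

Lemma seq_mul_add_nil x : sma [::] x <-> N x.
Proof.
split=> [[c [y [_ Ny ->]]]|Nx]; first by rewrite big_ord0 add0r.
by exists (fun=> 0), x; split=> // [_|]; [exact: ideal0 | rewrite big_ord0 add0r].
Qed.

(** Peels off the last element, so that statements about initial segments of a sequence go by
    induction on their length. *)
Lemma seq_mul_add_rcons s a x :
  sma (rcons s a) x <-> exists2 l, L l & sma s (x - a * l).
Proof.
split=> [/seq_mul_addE[c [y [Lc Ny ->]]]|[l Ll /seq_mul_addE[c [y [Lc Ny defx]]]]].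
  exists (c (size s)) => //; apply/seq_mul_addE; exists c, y; split=> //.
  rewrite size_rcons big_ord_recr /= nth_rcons ltnn eqxx.
  rewrite addrAC addrK; congr (_ + _).
  by apply: eq_bigr => i _; rewrite nth_rcons ltn_ord.
apply/seq_mul_addE.
exists (fun i => if (i < size s)%N then c i else l), y; split=> // [i|].
  by case: ifP.
rewrite size_rcons big_ord_recr /= nth_rcons ltnn eqxx -[LHS](subrK (a * l)).
rewrite defx addrAC; congr (_ + _ + _).
by apply: eq_bigr => i _; rewrite nth_rcons ltn_ord.
Qed.

End SeqMulAdd.

(** * Counting independent elements of bounded degree *)

Section Growth.
Context (K : fieldType) (k : nat).
Local Notation S := {mpoly K[k]}.
Implicit Types (L N : S -> Prop) (s x : S) (e m r d : nat).

Lemma idealZ N c x : ideal N -> N x -> N (c *: x).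
Proof. by move=> idN; rewrite -mul_mpolyC; apply: ideal_mull. Qed.

Definition indep_mod N r (f : 'I_r -> S) : Prop :=
  forall c : 'I_r -> K, N (\sum_i c i *: f i) -> forall i, c i = 0.

(** A lower bound [r] for the Hilbert function of [L/N]. As [msize] is the degree plus one, the
    elements have degree less than [m]. *)
Definition has_indep L N m r : Prop :=
  exists f : 'I_r -> S,
    [/\ forall i, L (f i), forall i, (msize (f i) <= m)%N & indep_mod N f].

(** Multiplication by [s] embeds [L/N] into the kernel of [L/N -> L/N'], so the two counts add up. A
    relation modulo [N] is first read modulo [N'], where the multiples of [s] disappear; then [s] is
    cancelled. *)
Lemma has_indepD L N N' s e m r r' :
  ideal L -> ideal N -> ideal N' ->
  (forall x, N x -> N' x) ->
  (forall x, L x -> N (s * x) -> N x) ->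
  (forall x, L x -> N' (s * x)) -> (msize s <= e)%N ->
  has_indep L N m r -> has_indep L N' (e + m) r' ->
  has_indep L N (e + m) (r + r').
Proof.
move=> idL idN idN' NN' sreg sL les [f [Lf lef indf]] [g [Lg leg indg]].
exists (fun i => match split i with inl a => s * f a | inr b => g b end).
split.
- by move=> i; case: (split i) => // a; apply: ideal_mull.
- move=> i; case: (split i) => // a.
  have [->|s0] := eqVneq s 0; first by rewrite mul0r msize0.
  have [->|f0] := eqVneq (f a) 0; first by rewrite mulr0 msize0.
  rewrite msizeM //; apply: leq_trans (leq_pred _) _.
  by apply: leq_add.
move=> c; rewrite big_split_ord /=.
under eq_bigr => i _ do rewrite (unsplitK (inl i)) /= scalerAr.
under [X in _ + X]eq_bigr => i _ do rewrite (unsplitK (inr i)).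
rewrite -mulr_sumr => Ncfg.
have Lcf (c' : 'I_r -> K) : L (\sum_i c' i *: f i).
  by apply: ideal_sum => // i _; apply: idealZ.
have cg0 j : c (rshift r j) = 0.
  move: j; apply: indg; rewrite -[X in N' X](addKr (s * \sum_i c (lshift r' i) *: f i)).
  rewrite addrC; apply: idealB => //; [exact: NN' | exact: sL].
have cf0 j : c (lshift r' j) = 0.
  move: j; apply: indf; apply: sreg => //; move: Ncfg.
  by rewrite [X in _ + X]big1 ?addr0 // => i _; rewrite cg0 scale0r.
by move=> i; rewrite -(splitK i); case: (split i).
Qed.

(** Double induction on [j], counting steps from the end of the chain, and on [m]. The class of [x]
    alone starts both inductions, and [has_indepD] gives the induction step through Pascal's
    rule. *)
Lemma has_indep_binomial L (N : nat -> S -> Prop) (s : nat -> S) d e x :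
  ideal L -> (forall i, (i <= d)%N -> ideal (N i)) ->
  (forall i, (i < d)%N ->
     [/\ forall y, N i y -> N i.+1 y,
         forall y, L y -> N i (s i * y) -> N i y,
         forall y, L y -> N i.+1 (s i * y)
       & (msize (s i) <= e)%N]) ->
  L x -> ~ N d x -> (msize x <= e)%N ->
  forall j m, (j <= d)%N -> has_indep L (N (d - j)%N) (e * m.+1) 'C(m + j, j).
Proof.
move=> idL idN chain Lx Nx lex.
have notN j : (j <= d)%N -> ~ N (d - j)%N x.
  elim: j => [|j IHj] lejd; first by rewrite subn0.
  move=> Njx; apply: (IHj (ltnW lejd)); have /chain[+ _ _ _]: (d - j.+1 < d)%N by lia.
  by rewrite -subSn // subSS; apply.
have one j m : (j <= d)%N -> has_indep L (N (d - j)%N) (e * m.+1) 1.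
  move=> lejd; exists (fun=> x); split=> // [_|c].
    by rewrite (leq_trans lex) // leq_pmulr.
  rewrite big_ord1 => Ncx i; rewrite ord1; apply/eqP; apply/negPn/negP => c0.
  apply: (notN j lejd); rewrite -[x]scale1r -(mulVf c0) -scalerA.
  by apply: idealZ => //; apply: idN; lia.
elim=> [|j IHj] m lejd; first by rewrite bin0; apply: one.
elim: m => [|m IHm]; first by rewrite binn; apply: one.
have lt_d : (d - j.+1 < d)%N by lia.
have [NN' sreg sL les] := chain _ lt_d.
rewrite addSn binS mulnS.
have defN' : (d - j.+1).+1 = (d - j)%N by lia.
apply: (@has_indepD L _ (N (d - j.+1).+1) (s (d - j.+1)%N)) => //.
- by apply: idN; lia.
- by apply: idN; lia.
- by rewrite defN' -mulnS -addSnnS; apply: IHj; lia.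
Qed.

End Growth.

(** * Substitution and growth bounds *)

Notation msubst := (mmap (@mpolyC _ _)).

Section Substitution.
Context (K : fieldType) (k : nat).

Lemma mpoly_ring_ind (P : {mpoly K[k]} -> Prop) :
  (forall c, P c%:MP) -> (forall p q, P p -> P q -> P (p + q)) ->
  (forall i p, P p -> P ('X_i * p)) -> forall p, P p.
Proof.
move=> PC PD PX; have PXm c (m : 'X_{1..k}) : P (c *: 'X_[m]).
  rewrite mpolyXE_id -mulr_algr alg_mpolyC; elim/big_rec: _ => [|i p _ Pp].
    by rewrite mul1r.
  rewrite -mulrA; elim: (m i) => [|a IHa]; first by rewrite mul1r.
  by rewrite exprS -mulrA; apply: PX.
by elim/mpolyind => [|c m p _ _ Pp]; [rewrite -mpolyC0; apply: PC | apply: PD].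
Qed.

Lemma rmorph_mpoly_eq (R : comNzRingType) (f g : {rmorphism {mpoly K[k]} -> R}) :
  (forall c, f c%:MP = g c%:MP) -> (forall i, f 'X_i = g 'X_i) -> f =1 g.
Proof.
move=> eqC eqX; apply: mpoly_ring_ind => // [p q|i p] eqp; last first.
  by rewrite !rmorphM eqX eqp.
by rewrite !rmorphD eqp => ->.
Qed.

Lemma mmapXU (R : comNzRingType) (f : {rmorphism K -> R}) (h : 'I_k -> R) i :
  mmap f h 'X_i = h i.
Proof. by rewrite mmapX mmap1U. Qed.

Context (D : nat) (h : 'I_k -> {mpoly K[D]}).

Lemma msize_mulS (p q : {mpoly K[D]}) a b :
  (msize p <= a.+1)%N -> (msize q <= b.+1)%N -> (msize (p * q) <= (a + b).+1)%N.
Proof.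
move=> lep leq.
have [->|p0] := eqVneq p 0; first by rewrite mul0r msize0.
have [->|q0] := eqVneq q 0; first by rewrite mulr0 msize0.
rewrite msizeM //; move: (msize p) (msize q) lep leq => u v; lia.
Qed.

Lemma msize_msubst c p : (forall i, msize (h i) <= c.+1)%N ->
  (msize (msubst h p) <= (c * msize p).+1)%N.
Proof.
move=> leh; have leX i a : (msize (h i ^+ a) <= (c * a).+1)%N.
  elim: a => [|a IHa]; first by rewrite expr0 msize1.
  by rewrite exprS mulnS; apply: msize_mulS.
rewrite /mmap; apply: leq_trans (msize_sum _ _ _) _.
apply/bigmax_leqP_seq => m /msize_mdeg_lt ltm _; rewrite mul_mpolyC.
apply: leq_trans (msizeZ_le _ _) _.
apply: (@leq_trans (c * mdeg m).+1); last by rewrite ltnS leq_mul2l ltnW ?orbT.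
rewrite mdegE /mmap1; elim/big_rec2: _ => [|i a p' _ IH]; first by rewrite msize1.
by rewrite mulnDr; apply: msize_mulS.
Qed.

End Substitution.

(** Polynomials of degree less than [M] involve only the [M ^ D] monomials with all exponents below
    [M]; the matrix of coefficients has independent rows, hence at most that many. *)
Lemma card_lin_indep (K : fieldType) (D r M : nat) (f : 'I_r -> {mpoly K[D]}) :
  (forall i, msize (f i) <= M)%N -> indep_mod (fun x => x = 0) f ->
  (r <= M ^ D)%N.
Proof.
move=> lef indf.
pose mon (u : {ffun 'I_D -> 'I_M}) : 'X_{1..D} := [multinom u l : nat | l < D].
pose A : 'M[K]_(r, #|{ffun 'I_D -> 'I_M}|) :=
  \matrix_(i, j) (f i)@_(mon (enum_val j)).
suff freeA : row_free A.
  have -> : (M ^ D = #|{ffun 'I_D -> 'I_M}|)%N by rewrite card_ffun !card_ord.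
  by rewrite -(eqP freeA) rank_leq_col.
apply: inj_row_free => v vA0; apply/rowP => i; rewrite mxE.
move: i; apply: indf; apply/mpolyP => m; rewrite mcoeff0 raddf_sum /=.
have [ltmM|leMm] := ltnP (mdeg m) M; last first.
  apply: big1 => i _; rewrite mcoeffZ [X in _ * X]memN_msupp_eq0 ?mulr0 //.
  by apply: msize_mdeg_ge; apply: leq_trans leMm.
have ltm l : (m l < M)%N.
  apply: leq_ltn_trans ltmM; rewrite mdegE (bigD1 l) //=; exact: leq_addr.
have -> : m = mon [ffun l => Ordinal (ltm l)].
  by apply/mnmP => l; rewrite mnmE ffunE.
move/rowP/(_ (enum_rank [ffun l => Ordinal (ltm l)])): vA0; rewrite !mxE => vA0.
rewrite -[RHS]vA0; apply: eq_bigr => i _.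
by rewrite mcoeffZ mxE enum_rankK.
Qed.

(** [msubst h] keeps families that are independent modulo [N] independent, and it multiplies degrees
    by at most a constant. *)
Lemma has_indep_bound (K : fieldType) (k D : nat) (h : 'I_k -> {mpoly K[D]})
    (L N : {mpoly K[k]} -> Prop) :
  ideal L -> (forall x, L x -> msubst h x = 0 -> N x) ->
  exists c, forall m r, has_indep L N m r -> (r <= (c * m.+1) ^ D)%N.
Proof.
move=> idL kerN; pose c := \max_i msize (h i).
exists c.+1 => m r [f [Lf lef indf]].
apply: (@card_lin_indep _ _ _ _ (msubst h \o f)) => [i /=|a sum0].
  apply: leq_trans (@msize_msubst _ _ _ h c _ _) _ => [j|].
    by apply: leqW; apply: leq_bigmax.
  by have := lef i; nia.
apply: indf; apply: kerN.
  by apply: ideal_sum => // i _; apply: idealZ.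
rewrite raddf_sum /= -[RHS]sum0; apply: eq_bigr => i _.
by rewrite mmapZ mul_mpolyC.
Qed.

Lemma binomial_growth_bound d D c :
  (forall m, 'C(m + d, d) <= (c * m.+1) ^ D)%N -> (d <= D)%N.
Proof.
move=> le_bin; rewrite leqNgt; apply/negP => ltDd.
have le_ffact m : (m.+1 ^ d <= (m + d) ^_ d)%N.
  elim: (d) => [|d' IHd]; first by rewrite ffactn0.
  by rewrite addnS ffactSS expnS; apply: leq_mul; rewrite ?ltnS ?leq_addr.
(* Taking [m = B] gives [(B + 1)^d <= d! c^D (B + 1)^D = B (B + 1)^D < (B + 1)^(D + 1)], impossible
   for [d > D]. *)
pose B := (d`! * c ^ D)%N; have := le_ffact B; rewrite -bin_ffact => le1.
have: (B.+1 ^ d <= B * B.+1 ^ D)%N.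
  apply: leq_trans le1 _; rewrite mulnC /B -mulnA leq_mul2l -expnMn.
  by rewrite le_bin orbT.
have -> : d = (D + (d - D.+1).+1)%N by lia.
rewrite expnD mulnC leq_pmul2r ?expn_gt0 // leqNgt => /negP; apply.
by rewrite expnS; apply: leq_pmulr; rewrite expn_gt0.
Qed.

Section UpperBounds.
Context (K : fieldType) (k D : nat) (h : 'I_k -> {mpoly K[D]}).
Context (L N : {mpoly K[k]} -> Prop) (idL : ideal L).
Context (kerN : forall x, L x -> msubst h x = 0 -> N x).

(** Serves both upper bounds. For the depth, [P i] comes from the first [i] elements of a regular
    sequence; for the dimension, [L] is the whole ring and [P] a chain of primes. Either way
    binomial growth of degree [d] meets polynomial growth of degree [D]. *)
Lemma regular_chain_length (P : nat -> {mpoly K[k]} -> Prop) d x :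
  (forall y, N y -> P 0%N y) -> (forall i, (i <= d)%N -> ideal (P i)) ->
  (forall i, (i < d)%N -> (forall y, P i y -> P i.+1 y) /\
     exists s, (forall y, L y -> P i (s * y) -> P i y) /\
               (forall y, L y -> P i.+1 (s * y))) ->
  L x -> ~ P d x -> (d <= D)%N.
Proof.
move=> NP idP chain Lx Px.
have /fin_all_exists[s sP] (i : 'I_d) := (chain i (ltn_ord i)).2.
pose s' i := if insub i is Some j then s j else 0.
pose e := (msize x + \max_i msize (s i))%N.
have [|c bound] := @has_indep_bound K k D h L (P 0%N) idL.
  by move=> y Ly /(kerN Ly)/NP.
apply: (@binomial_growth_bound _ _ (c * e.+1)%N) => m.
have chain' i : (i < d)%N ->
    [/\ forall y, P i y -> P i.+1 y,
        forall y, L y -> P i (s' i * y) -> P i y,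
        forall y, L y -> P i.+1 (s' i * y)
      & (msize (s' i) <= e)%N].
  move=> ltid; have [PP _] := chain i ltid; have [sreg sL] := sP (Ordinal ltid).
  rewrite /s' insubT; split=> //.
  by apply: leq_trans (leq_addl _ _); apply: leq_bigmax.
have := has_indep_binomial idL idP chain' Lx Px (leq_addr _ _) m (leqnn d).
rewrite subnn => /bound leb.
apply: leq_trans leb _; case: (D) => // D'.
by rewrite leq_exp2r // -mulnA leq_mul2l; apply/orP; right; nia.
Qed.

End UpperBounds.

(** * Cohen-Macaulayness from freeness *)

Section Kill.
Context (K : fieldType) (D : nat).
Local Notation A := {mpoly K[D]}.

(** The quotient by the variables with index in [Z], realised as an endomorphism of the same ring,
    so that all these quotients live in one type. *)
Definition kill (Z : pred nat) : A -> A :=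
  msubst (fun l : 'I_D => if Z l then 0 else 'X_l).

HB.instance Definition _ Z := GRing.RMorphism.on (kill Z).

Lemma kill_C Z c : kill Z c%:MP = c%:MP.
Proof. exact: mmapC. Qed.

Lemma kill_X Z i : kill Z 'X_i = if Z i then 0 else 'X_i.
Proof. exact: mmapXU. Qed.

Lemma kill_sub (Z Z' : pred nat) f :
  (forall l, Z l -> Z' l) -> kill Z' (kill Z f) = kill Z' f.
Proof.
move=> sZ; move: f.
apply: (rmorph_mpoly_eq (f := kill Z' \o kill Z) (g := kill Z')) => [c|i] /=.
  by rewrite !kill_C.
rewrite (kill_X Z); case: ifP => [/sZ Zi|_] //.
by rewrite kill_X Zi rmorph0.
Qed.

Lemma kill_sub0 (Z Z' : pred nat) f :
  (forall l, Z l -> Z' l) -> kill Z f = 0 -> kill Z' f = 0.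
Proof. by move=> sZ f0; rewrite -(kill_sub _ sZ) f0 rmorph0. Qed.

Lemma mpolyXU_neq0 (i : 'I_D) : 'X_i != 0 :> A.
Proof. by rewrite -msize_poly_eq0 msizeX. Qed.

(** Division by [X_i] modulo the variables below [i]. The quotient [b] is built along the generation
    of [f] by variables; a factor [X_i] itself contributes its cofactor. *)
Lemma kill_low_step (i : 'I_D) f :
  exists b, kill (fun l => (l < i)%N) f - kill (fun l => (l < i.+1)%N) f
            = kill (fun l => (l < i)%N) ('X_i * b).
Proof.
elim/mpoly_ring_ind: f => [c|p q [b eqb] [b' eqb']|j p [b eqb]].
- by exists 0; rewrite !kill_C subrr mulr0 rmorph0.
- by exists (b + b'); rewrite mulrDr !rmorphD /= opprD addrACA eqb eqb'.
rewrite !rmorphM /= !kill_X ltnS [(j <= i)%N]leq_eqVlt; have [ltji|] := ltnP j i.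
  by exists 0; rewrite orbT !mul0r subr0 mulr0 rmorph0.
rewrite leq_eqVlt [(i : nat) == j]eq_sym; case/predU1P=> [/val_inj ->|ltij].
  by exists p; rewrite eqxx /= mul0r subr0 rmorphM /= kill_X ltnn.
exists ('X_j * b); rewrite gtn_eqF //= -mulrBr eqb mulrCA !rmorphM /= !kill_X.
by have -> : (j < i)%N = false by lia.
Qed.

End Kill.

Section CohenMacaulayCriterion.
Context (K : fieldType) (k D : nat) (h : 'I_k -> {mpoly K[D]}).
Local Notation S := {mpoly K[k]}.
Local Notation Phi := (msubst h).
Context (L N : S -> Prop) (idL : ideal L) (idN : ideal N).
Context (E : finType) (k0 : E) (e : E -> S) (theta : nat -> S).
(** A combination of the [e k] with coefficients in the subring generated by the [theta l]. The
    hypotheses [span] and [free] make [L/N] a free module over this polynomial ring with basis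
    [e]. *)
Local Notation comb a :=
  (\sum_(k : E) msubst (fun l : 'I_D => theta l) (a k) * e k).

Context (Phi_N : forall x, N x -> Phi x = 0) (Le : forall i, L (e i)).
Context (span : forall x, L x -> exists a : E -> {mpoly K[D]}, N (x - comb a)).
Context (free : forall a : E -> {mpoly K[D]},
  Phi (comb a) = 0 -> forall i, a i = 0).

(** Modulo [N] the element [x] is some [comb a], and [Phi] detects the coefficients. Thus [Phi]
    embeds [L/N] in a polynomial ring in [D] variables. *)
Let kerN x : L x -> Phi x = 0 -> N x.
Proof.
move=> Lx Phi_x; have [a Nxa] := span Lx; apply: (idealBl idN Nxa).
have a0 : forall i, a i = 0.
  apply: free; have /eqP := Phi_N Nxa; rewrite rmorphB /= Phi_x sub0r oppr_eq0.
  by move/eqP.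
by rewrite big1 => [|i _]; [exact: ideal0 | rewrite a0 rmorph0 mul0r].
Qed.

Let comb_L a : L (comb a).
Proof. by apply: ideal_sum => // i _; apply: ideal_mull. Qed.

(** By freeness, membership is tested on each coordinate, where it means lying in the ideal of the
    first [i] variables, the kernel of [kill]. *)
Let seq_mul_addP (i : nat) x (a : E -> {mpoly K[D]}) :
  L x -> N (x - comb a) -> (i <= D)%N ->
  @seq_mul_add S S^o (mkseq theta i) L N x <->
    forall j, kill (fun l => (l < i)%N) (a j) = 0.
Proof.
elim: i x a => [|i IHi] x a Lx Nxa leiD.
  rewrite seq_mul_add_nil //; split=> [Nx j|a0].
    suff -> : a j = 0 by rewrite rmorph0.
    move: j; apply: free; apply/eqP; rewrite -oppr_eq0 -sub0r.
    by move/eqP: (Phi_N Nxa); rewrite rmorphB /= (Phi_N Nx).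
  apply: (idealBl idN Nxa); rewrite big1 => [|j _]; first exact: ideal0.
  have := a0 j; rewrite (_ : kill _ _ = a j) => [->|]; first by rewrite rmorph0 mul0r.
  apply: (rmorph_mpoly_eq (f := kill (fun l => (l < 0)%N)) (g := idfun)) => [c|l] /=.
    exact: kill_C.
  by rewrite kill_X.
pose o := Ordinal leiD.
have shift l b : N (l - comb b) ->
    N (x - theta i * l - comb (fun j => a j - 'X_o * b j)).
  move=> Nlb.
  have -> : comb (fun j => a j - 'X_o * b j) = comb a - theta i * comb b.
    rewrite mulr_sumr -sumrB; apply: eq_bigr => j _.
    by rewrite rmorphB rmorphM /= mmapXU mulrBl mulrA.
  have -> : x - theta i * l - (comb a - theta i * comb b) =
      (x - comb a) - theta i * (l - comb b) by ring.
  by apply: idealB => //; apply: ideal_mull.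
rewrite mkseqS seq_mul_add_rcons //; split=> [[l Ll]|a0].
  have [b Nlb] := span Ll.
  move/(IHi _ _ _ (shift l b Nlb) (ltnW leiD)) => ab0 j.
  have /ab0/(_ j) : L (x - theta i * l) by apply: idealB => //; apply: ideal_mull.
  move/(@kill_sub0 _ _ _ (fun l => (l < i.+1)%N) _ (fun l => @leqW l.+1 i)).
  by rewrite rmorphB rmorphM /= kill_X ltnSn mul0r subr0.
(* Each coordinate is divided by [X_i] modulo the lower variables; the quotients are the coordinates
   of the factor of [theta i]. *)
have /fin_all_exists[b bP] j := kill_low_step o (a j).
exists (comb b) => //.
apply/(IHi _ _ _ (shift _ b _) (ltnW leiD)).
- by apply: idealB => //; apply: ideal_mull.
- by rewrite subrr; apply: ideal0.
by move=> j; rewrite rmorphB /= -bP a0 subr0 subrr.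
Qed.

Context (theta_irr : forall i, (i < D)%N -> irrelevant_ideal (theta i)).
(** Makes consecutive primes of the chain below differ. *)
Context (witness : forall j, (j < D)%N -> exists g,
  kill (leq j) (Phi g) = 0 /\ kill (leq j.+1) (Phi g) <> 0).

Let comb_delta : comb (fun k => (k == k0)%:R) = e k0.
Proof.
rewrite (bigD1 k0) //= eqxx rmorph1 mul1r big1 ?addr0 // => j /negbTE->.
by rewrite rmorph0 mul0r.
Qed.

Let delta_free : ~ forall k, (k == k0)%:R = 0 :> {mpoly K[D]}.
Proof. by move/(_ k0)/eqP; rewrite eqxx oner_eq0. Qed.

Let Phi_e : Phi (e k0) != 0.
Proof.
by apply/eqP; rewrite -comb_delta => /free/delta_free.
Qed.

(** On coordinates [theta i] acts as [X_i], a nonzerodivisor modulo the variables before it; the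
    last quotient is nonzero because [e k0] has a coordinate 1. *)
Lemma has_depth_of_free :
  @has_depth S (@irrelevant_ideal K k) S^o L N D.
Proof.
split.
  exists (mkseq theta D); split; first by rewrite size_mkseq.
    by move=> _ /mapP[i + ->]; rewrite mem_iota add0n => /theta_irr.
  have takeE i : (i <= D)%N -> take i (mkseq theta D) = mkseq theta i.
    by move=> leiD; rewrite /mkseq -map_take take_iota (minn_idPl leiD).
  split=> [i + x Lx|].
    rewrite size_mkseq => ltiD; rewrite takeE 1?ltnW // nth_mkseq //.
    have [a Nxa] := span Lx.
    rewrite (seq_mul_addP Lx Nxa (ltnW ltiD)).
    have Ltx : L (theta i * x) by apply: ideal_mull.
    pose o := Ordinal ltiD.
    have Ntx : N (theta i * x - comb (fun k => 'X_o * a k)).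
      have -> : comb (fun k => 'X_o * a k) = theta i * comb a.
        rewrite mulr_sumr; apply: eq_bigr => j _.
        by rewrite rmorphM /= mmapXU mulrA.
      by rewrite -mulrBr; apply: ideal_mull.
    move/(seq_mul_addP Ltx Ntx (ltnW ltiD)) => Xa0 j; apply/eqP.
    have /eqP := Xa0 j; rewrite rmorphM /= kill_X ltnn mulf_eq0.
    by rewrite (negbTE (mpolyXU_neq0 _ _)).
  exists (e k0); split=> //.
  have Ne : N (e k0 - comb (fun k => (k == k0)%:R)).
    by rewrite comb_delta subrr; apply: ideal0.
  move/(seq_mul_addP (Le k0) Ne (leqnn D))/(_ k0)/eqP.
  by rewrite eqxx rmorph1 oner_eq0.
(* The initial segments of an arbitrary regular sequence form a chain to which the growth bound
   applies. *)
move=> s _ [sreg [x [Lx Nx]]].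
apply: (@regular_chain_length _ _ _ h L N idL kerN
  (fun i => @seq_mul_add S S^o (take i s) L N) _ x) => //.
- by move=> y Ny; rewrite take0 seq_mul_add_nil.
- by move=> i _; apply: ideal_seq_mul_add.
- move=> i lti; rewrite (take_nth 0 lti); split=> [y sy|].
    apply/seq_mul_add_rcons; exists 0; first exact: ideal0.
    by rewrite mulr0 subr0.
  exists s`_i; split=> [y Ly|y Ly]; first exact: sreg.
  apply/seq_mul_add_rcons; exists y => //.
  by rewrite subrr; apply: ideal0; apply: ideal_seq_mul_add.
- by rewrite take_size.
Qed.

Lemma has_dim_of_free : @has_dim S S^o L N D.
Proof.
split.
  (* The preimages under [Phi] of the ideals of the last [i] variables. They are prime as kernels of
     maps to a domain, and contain the annihilator since [Phi (e k0)] is nonzero. *)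
  exists (fun i f => kill (leq (D - i)) (Phi f) = 0); split=> i leiD.
    split.
      split; first split.
      - by rewrite !rmorph0.
      - by move=> x y x0 y0; rewrite !rmorphD /= x0 y0 addr0.
      - by move=> a x x0; rewrite [a *: x]/(a * x) !rmorphM /= x0 mulr0.
      - by rewrite !rmorph1; apply/eqP/oner_neq0.
      - move=> a b; rewrite !rmorphM => /eqP; rewrite mulf_eq0.
        by case/orP=> /eqP; [left | right].
    move=> a /(_ _ (Le k0))/Phi_N; rewrite [_ *: _]/(a * e k0) rmorphM /=.
    move/eqP; rewrite mulf_eq0 (negbTE Phi_e) orbF => /eqP->.
    exact: rmorph0.
  split=> [a|].
    by apply: kill_sub0 => l; apply: leq_trans; apply: leq_sub2l.
  have /witness[g [g0 gn0]] : (D - i.+1 < D)%N by lia.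
  exists g; split=> //.
  by have <- : (D - i.+1).+1 = (D - i)%N by lia.
(* For the bound, the whole ring and the annihilator take the places of [L] and [N]. An element of
   [P i.+1] outside [P i] is regular modulo the prime [P i]. *)
move=> d [P [primeP chainP]].
have idT : ideal (fun _ : S => True) by [].
apply: (@regular_chain_length _ _ _ h _ (@annihilator S S^o L N) idT _ P _ 1) => //.
- move=> x _ Phi_x y Ly; apply: kerN; first exact: ideal_mull.
  by rewrite [_ *: _]/(x * y) rmorphM /= Phi_x mul0r.
- by have [_ +] := primeP _ (leq0n d).
- by move=> i /primeP[[]].
- move=> i ltid; have [PP [s [Ps Pns]]] := chainP _ ltid; split=> //.
  have [[_ _ primePi] _] := primeP _ (ltnW ltid).
  have [[idPi _ _] _] := primeP _ ltid.
  exists s; split=> [y _ /primePi[/Pns|]|y _] //.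
  exact: ideal_mulr.
- by have [[]] := primeP _ (leqnn d).
Qed.

Lemma cohen_macaulay_of_free : cohen_macaulay_of_dim L N D.
Proof. by split; [exact: has_dim_of_free | exact: has_depth_of_free]. Qed.

End CohenMacaulayCriterion.

(** * Freeness by degrees *)

(** A nonzero term of index [i] has degree [p * deg (P i) + i]. These degrees differ modulo [p], so
    the leading terms cannot cancel. *)
Lemma comp_poly_indep (R : idomainType) (p : nat) (F : {poly R})
    (e P : 'I_p -> {poly R}) :
  size F = p.+1 -> (forall i, size (e i) = i.+1) ->
  \sum_i (P i \Po F) * e i = 0 -> forall i, P i = 0.
Proof.
move=> szF sze sum0 i0; apply/eqP; apply/negPn/negP => Pi0.
have p_gt0 : (0 < p)%N by apply: leq_ltn_trans (ltn_ord i0).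
pose f i := (P i \Po F) * e i.
have szf i : P i != 0 -> size (f i) = ((size (P i)).-1 * p + i).+1.
  move=> Pi; have e0 : e i != 0 by rewrite -size_poly_eq0 sze.
  have c0 : P i \Po F != 0 by rewrite comp_poly_eq0 // szF.
  rewrite size_mul // sze addnS /= -[size (P i \Po F)]prednK ?size_poly_gt0 //.
  by rewrite size_comp_poly szF.
case: (@arg_maxnP _ i0 (fun i => P i != 0) (fun i => size (f i)) Pi0) => i Pi maxi.
have := congr1 (fun g : {poly R} => g`_(size (f i)).-1) sum0.
rewrite coef_sum coef0 (bigD1 i) //= -/(f i) [X in _ + X]big1 => [|j ji]; last first.
  rewrite -/(f j); have [Pj|Pj] := eqVneq (P j) 0.
    by rewrite /f Pj comp_poly0 mul0r coef0.
  have lej : (size (f j) <= size (f i))%N := maxi j Pj.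
  have nej : size (f j) != size (f i).
    apply: contraNneq ji; rewrite !szf // => -[] /(congr1 (modn^~ p)).
    by rewrite !modnMDl !modn_small // => /val_inj->.
  by apply: nth_default; move: lej nej; rewrite (szf i) //=; lia.
rewrite addr0 => /eqP; rewrite lead_coef_eq0 -size_poly_eq0 szf //.
Qed.

Section MuniVariables.
Context (K : fieldType).

(* Variables are indexed by [nat], with [mvar N j = 0] for [N <= j]. *)
Definition mvar N j : {mpoly K[N]} := if insub j is Some i then 'X_i else 0.

Lemma mvarE N (i : 'I_N) : mvar N i = 'X_i.
Proof. by rewrite /mvar valK. Qed.

Lemma mvar_neq0 N j : (j < N)%N -> mvar N j != 0.
Proof. by move=> ltjN; rewrite (mvarE (Ordinal ltjN)) mpolyXU_neq0. Qed.

Lemma kill_mvar N Z j : kill Z (mvar N j) = if Z j then 0 else mvar N j.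
Proof.
rewrite /mvar; case: insubP => [i _ <-|_]; first exact: kill_X.
by rewrite rmorph0 if_same.
Qed.

(** [muni] makes the last variable the indeterminate of a univariate polynomial, which is why the
    variables called [w] are placed last later on. *)
Lemma muniX N (i : 'I_N.+1) :
  muni ('X_i : {mpoly K[N.+1]}) = if i == N :> nat then 'X else (mvar N i)%:P.
Proof.
rewrite muniE msuppX big_seq1 mcoeffX eqxx scale1r mnm1E.
have [eqiN|neiN] := eqVneq (i : nat) N.
  have -> : i = ord_max by apply: val_inj.
  rewrite eqxx expr1 (_ : [multinom _ | _ < _] = 0%MM) ?mpolyX0 ?scale1r //.
  by apply/mnmP => j; rewrite mnmE mnm1E mnm0E -val_eqE /= gtn_eqF.
have ltiN : (i < N)%N by have := ltn_ord i; rewrite ltnS leq_eqVlt (negPf neiN).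
have -> : (i == ord_max) = false by rewrite -val_eqE (negPf neiN).
rewrite expr0 alg_polyC (mvarE (Ordinal ltiN)); congr ('X_[_])%:P.
by apply/mnmP => j; rewrite mnmE !mnm1E -!val_eqE.
Qed.

Lemma muni_mvar N j :
  muni (mvar N.+1 j) = if j == N then 'X else (mvar N j)%:P.
Proof.
have [ltj|lej] := ltnP j N.+1; first by rewrite (mvarE (Ordinal ltj)) muniX.
have j0 M : (M <= j)%N -> mvar M j = 0.
  by move=> leMj; rewrite /mvar insubF // ltnNge leMj.
by rewrite gtn_eqF // !j0 // 1?ltnW // muni0.
Qed.

(** Evaluation at the last variable, after widening the coefficients, is a left inverse. *)
Lemma muni_inj N : injective (@muni N K).
Proof.
pose g := horner_eval ('X_ord_max : {mpoly K[N.+1]}) \o map_poly (@mwiden N K).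
have gK : cancel (@muni N K) g.
  apply: (rmorph_mpoly_eq (f := g \o @muni N K) (g := idfun)) => [c|i] /=.
    by rewrite muniC map_polyC /= /horner_eval hornerC mwidenC.
  rewrite muniX; case: eqP => [eqiN|neiN].
    rewrite map_polyX /horner_eval hornerX; congr 'X_[U_(_)].
    exact: val_inj.
  have ltiN : (i < N)%N by have := ltn_ord i; rewrite ltnS leq_eqVlt => /predU1P[].
  rewrite map_polyC /= /horner_eval hornerC (mvarE (Ordinal ltiN)) mwidenX mnmwiden1.
  by congr 'X_[U_(_)]; apply: val_inj.
exact: can_inj gK.
Qed.

Lemma eq_msubst k D (h h' : 'I_k -> {mpoly K[D]}) : h =1 h' -> msubst h =1 msubst h'.
Proof.
move=> eqh; apply: (rmorph_mpoly_eq (f := msubst h) (g := msubst h')) => [c|i] /=.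
  by rewrite !mmapC.
by rewrite !mmapXU.
Qed.

Lemma msubst_comp k D D' (h : 'I_k -> {mpoly K[D]}) (h' : 'I_D -> {mpoly K[D']}) a :
  msubst h' (msubst h a) = msubst (msubst h' \o h) a.
Proof.
move: a; apply: (rmorph_mpoly_eq (f := msubst h' \o msubst h)
  (g := msubst (msubst h' \o h))) => [c|i] /=.
  by rewrite !mmapC.
by rewrite !mmapXU.
Qed.

Section OneColour.
Context (N p : nat) (F : {mpoly K[N.+1]}) (e : 'I_p -> {mpoly K[N.+1]}).
Context (szF : size (muni F) = p.+1) (sze : forall i, size (muni (e i)) = i.+1).

(** The shape of the images of the parameters [theta] for the complete graph. In the last variable
    it becomes composition with [muni F]. *)
Definition last_subst (l : nat) := if l == N then F else mvar N.+1 l.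

Local Notation sub := (msubst (fun l : 'I_N.+1 => last_subst l)).

Lemma muni_last_subst a : muni (sub a) = muni a \Po muni F.
Proof.
move: a; apply: (rmorph_mpoly_eq (f := @muni N K \o sub)
  (g := comp_poly (muni F) \o @muni N K)) => [c|i] /=.
  by rewrite mmapC !muniC comp_polyC.
rewrite mmapXU muniX /last_subst; case: eqP => [_|/eqP/negPf neiN].
  by rewrite comp_polyX.
by rewrite muni_mvar neiN comp_polyC.
Qed.

Lemma last_subst_indep (c : 'I_p -> {mpoly K[N.+1]}) :
  \sum_i sub (c i) * e i = 0 -> forall i, c i = 0.
Proof.
move=> sum0 i; apply: muni_inj; rewrite muni0; move: i.
apply: (comp_poly_indep szF sze).
move/(congr1 (@muni N K)): sum0; rewrite muni0 => sum0; rewrite -[RHS]sum0.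
rewrite raddf_sum; apply: eq_bigr => i _.
by rewrite /= muniM muni_last_subst.
Qed.

End OneColour.

Section TwoColours.
Context (N p q : nat) (FA : {mpoly K[N.+1]}) (eA : 'I_p -> {mpoly K[N.+1]}).
Context (szFA : size (muni FA) = p.+1).
Context (szeA : forall i, size (muni (eA i)) = i.+1).
Context (FA' FB : {mpoly K[N.+2]}).
Context (eA' : 'I_p -> {mpoly K[N.+2]}) (eB : 'I_q -> {mpoly K[N.+2]}).
Context (muniFA' : muni FA' = FA%:P) (muni_eA' : forall i, muni (eA' i) = (eA i)%:P).
Context (szFB : size (muni FB) = q.+1).
Context (szeB : forall j, size (muni (eB j)) = j.+1).

Definition last2_subst (l : nat) :=
  if l == N.+1 then FB else if l == N then FA' else mvar N.+2 l.

Local Notation sub1 := (msubst (fun l : 'I_N.+1 => last_subst FA l)).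
Local Notation sub2 := (msubst (fun l : 'I_N.+2 => last2_subst l)).

Lemma muni_last2_subst a :
  muni (sub2 a) = map_poly sub1 (muni a) \Po muni FB.
Proof.
move: a; apply: (rmorph_mpoly_eq (f := @muni N.+1 K \o sub2)
  (g := comp_poly (muni FB) \o (map_poly sub1 \o @muni N.+1 K))) => [c|i] /=.
  by rewrite mmapC !muniC map_polyC comp_polyC /= mmapC.
rewrite mmapXU muniX /last2_subst; case: eqP => [_|/eqP neiN].
  by rewrite map_polyX comp_polyX.
have ltiN : (i < N.+1)%N by have := ltn_ord i; rewrite ltnS leq_eqVlt (negPf neiN).
rewrite map_polyC comp_polyC /= (mvarE (Ordinal ltiN)) mmapXU /last_subst /=.
by case: eqP => // _; rewrite muni_mvar (negPf neiN).
Qed.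

(** The degree argument applied twice: in the last variable for the index [j], then, coefficient by
    coefficient, in the variable before it for the index [i]. *)
Lemma last2_subst_indep (c : 'I_p * 'I_q -> {mpoly K[N.+2]}) :
  \sum_i sub2 (c i) * (eA' i.1 * eB i.2) = 0 -> forall i, c i = 0.
Proof.
move=> sum0 [i j]; apply: muni_inj; rewrite muni0.
pose P j := \sum_i map_poly sub1 (muni (c (i, j))) * (eA i)%:P.
have P0 : forall j, P j = 0.
  apply: (comp_poly_indep szFB szeB).
  rewrite -[RHS](muni0 N.+1 K) -sum0; have -> : \sum_i sub2 (c i) * (eA' i.1 * eB i.2) =
      \sum_j \sum_i sub2 (c (i, j)) * (eA' i * eB j).
    by rewrite exchange_big pair_bigA /=; apply: eq_bigr => -[].
  rewrite raddf_sum; apply: eq_bigr => l _.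
  rewrite /P !raddf_sum mulr_suml; apply: eq_bigr => m _.
  by rewrite /= !muniM muni_last2_subst muni_eA' comp_polyM comp_polyC mulrA.
apply/polyP => m; rewrite coef0; move: i.
apply: (last_subst_indep szFA szeA).
move/(congr1 (fun f : {poly {mpoly K[N.+1]}} => f`_m)): (P0 j).
rewrite coef0 => P0m; rewrite -[RHS]P0m.
rewrite coef_sum; apply: eq_bigr => i _.
by rewrite coefMC coef_map.
Qed.

End TwoColours.
End MuniVariables.

(** * Diagonal sequences *)

Section SegreSequences.
Context (R : comNzRingType).
Implicit Types (T x y : nat -> R) (w : R) (i j : nat).

(** In closed form, the sum of [T j * w ^ (i - j)] over [j <= i]. *)
Fixpoint tseq T w i : R := if i is j.+1 then T i + w * tseq T w j else T 0%N.

(** Together with the last [y], the usual linear system of parameters modulo the 2-minors of the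
    matrix with rows [x] and [y]. *)
Definition diag_seq x y i : R := if i is j.+1 then x i - y j else x 0%N.

Lemma diag_tseq T w i :
  diag_seq (tseq T w) (fun j => w * tseq T w j) i = T i.
Proof. by case: i => //= i; rewrite addrK. Qed.

Lemma tseq0 T i : tseq T 0 i = T i.
Proof. by case: i => //= i; rewrite mul0r addr0. Qed.

Lemma eq_tseq T T' w i :
  (forall j, (j <= i)%N -> T j = T' j) -> tseq T w i = tseq T' w i.
Proof.
elim: i => [|i IHi] eqT /=; first exact: eqT.
by rewrite eqT // IHi // => j leji; apply: eqT; apply: leqW.
Qed.

Lemma eq_diag_seq x x' y y' i :
  (forall j, (j <= i)%N -> x j = x' j /\ y j = y' j) ->
  diag_seq x y i = diag_seq x' y' i.
Proof.
case: i => [|i] eqxy /=; first by have [] := eqxy 0%N.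
by have [-> _] := eqxy i.+1 (leqnn _); have [_ ->] := eqxy i (leqnSn _).
Qed.

Section SpanMul.
(** [W] stands for a span over the parameters and [tau] for a sequence that is proportional to [x]
    and to [y] up to [W]: the row [y] itself for the complete graph, minors with one fixed column
    for the two cliques. *)
Context (W : R -> Prop) (p : nat) (x y tau : nat -> R).
Context (WD : forall f g, W f -> W g -> W (f + g)) (WN : forall f, W f -> W (- f)).
Context (W_diag : forall i f, (i < p)%N -> W f -> W (diag_seq x y i * f)).
Context (W_last : forall f, W f -> W (y p.-1 * f)).
Context (W_tau : forall i, (i < p)%N -> W (tau i)).
Context (W_minor_x : forall i j, (i < p)%N -> (j < p)%N ->
  W (x i * tau j - x j * tau i)).
Context (W_minor_y : forall i j, (i < p)%N -> (j < p)%N ->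
  W (y i * tau j - y j * tau i)).

(* Up to terms in [W], [y a * tau i.+1] equals [y a.+1 * tau i]; this walk ends
   at [x 0 * tau a.+1] or at [y p.-1 * tau i]. *)
Lemma span_mul_y i a : (i < p)%N -> (a < p)%N -> W (y a * tau i).
Proof.
elim: i a => [|i IHi] a ltip ltap; have [lta|lea] := ltnP a.+1 p.
- have -> : y a * tau 0%N = - (diag_seq x y a.+1 * tau 0%N) +
      (diag_seq x y 0%N * tau a.+1 - (x 0%N * tau a.+1 - x a.+1 * tau 0%N)).
    by rewrite /=; ring.
  apply: WD; first by apply/WN/W_diag => //; apply: W_tau.
  by apply: WD; [apply/W_diag => //; apply: W_tau | apply/WN/W_minor_x].
- by have -> : a = p.-1 by [lia]; apply/W_last/W_tau.
- have -> : y a * tau i.+1 = - (diag_seq x y a.+1 * tau i.+1) +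
      (diag_seq x y i.+1 * tau a.+1 - (x i.+1 * tau a.+1 - x a.+1 * tau i.+1)
        + ((y i * tau a.+1 - y a.+1 * tau i) + y a.+1 * tau i)).
    by rewrite /=; ring.
  apply: WD; first by apply/WN/W_diag => //; apply: W_tau.
  apply: WD.
    by apply: WD; [apply/W_diag => //; apply: W_tau | apply/WN/W_minor_x].
  by apply: WD; [apply: W_minor_y => //; lia | apply: IHi => //; lia].
- by have -> : a = p.-1 by [lia]; apply/W_last/W_tau.
Qed.

Lemma span_mul_x i a : (i < p)%N -> (a < p)%N -> W (x a * tau i).
Proof.
move=> ltip; case: a => [|a] ltap; first by apply: (W_diag ltap); apply: W_tau.
have -> : x a.+1 * tau i = diag_seq x y a.+1 * tau i + y a * tau i.
  by rewrite /=; ring.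
apply: WD; first by apply/W_diag => //; apply: W_tau.
by apply: span_mul_y => //; apply: ltnW.
Qed.

End SpanMul.
End SegreSequences.

Lemma rmorph_tseq (R R' : comNzRingType) (f : {rmorphism R -> R'}) T w i :
  f (tseq T w i) = tseq (f \o T) (f w) i.
Proof. by elim: i => //= i IHi; rewrite rmorphD rmorphM IHi. Qed.

Lemma muni_tseq (K : fieldType) N (T : nat -> {mpoly K[N.+1]}) w i :
  muni (tseq T w i) = tseq (fun j => muni (T j)) (muni w) i.
Proof. by elim: i => //= i <-; rewrite muniD muniM. Qed.

Lemma rmorph_diag_seq (R R' : comNzRingType) (f : {rmorphism R -> R'}) x y i :
  f (diag_seq x y i) = diag_seq (f \o x) (f \o y) i.
Proof. by case: i => //= i; rewrite rmorphB. Qed.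

Lemma size_tseq (R : idomainType) (c : nat -> R) i :
  c 0%N != 0 -> size (tseq (fun j => (c j)%:P) 'X i) = i.+1.
Proof.
move=> c0; elim: i => [|i IHi] /=; first by rewrite size_polyC c0.
rewrite addrC mulrC size_MXaddC IHi.
by rewrite -size_poly_eq0 IHi.
Qed.

(** * Spans over the parameters modulo an ideal *)

Section Spanned.
Context (K : fieldType) (k D : nat) (N : {mpoly K[k]} -> Prop) (idN : ideal N).
Context (E : finType) (e : E -> {mpoly K[k]}) (theta : nat -> {mpoly K[k]}).
Local Notation ev a := (msubst (fun l : 'I_D => theta l) a).

Definition spanned (x : {mpoly K[k]}) : Prop :=
  exists a : E -> {mpoly K[D]}, N (x - \sum_i ev (a i) * e i).

Lemma spanned_ideal x : N x -> spanned x.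
Proof.
by move=> Nx; exists (fun=> 0); rewrite big1 ?subr0 // => i _; rewrite rmorph0 mul0r.
Qed.

Lemma spannedD x y : spanned x -> spanned y -> spanned (x + y).
Proof.
move=> [a Na] [b Nb]; exists (fun i => a i + b i).
under eq_bigr => i _ do rewrite rmorphD mulrDl.
by rewrite big_split opprD addrACA; apply: idealD.
Qed.

Lemma spanned_ev f x : spanned x -> spanned (ev f * x).
Proof.
move=> [a Na]; exists (fun i => f * a i).
under eq_bigr => i _ do rewrite rmorphM -mulrA.
by rewrite -mulr_sumr -mulrBr; apply: ideal_mull.
Qed.

Lemma spanned_C c x : spanned x -> spanned (c%:MP * x).
Proof. by move/(spanned_ev c%:MP); rewrite mmapC. Qed.

Lemma spannedN x : spanned x -> spanned (- x).
Proof. by move/(spanned_C (-1)); rewrite rmorphN1 mulN1r. Qed.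

Lemma spanned_theta l x : (l < D)%N -> spanned x -> spanned (theta l * x).
Proof.
by move=> ltlD /(spanned_ev 'X_(Ordinal ltlD)); rewrite mmapXU.
Qed.

Lemma spanned_gen i : spanned (e i).
Proof.
exists (fun j => (j == i)%:R); rewrite (bigD1 i) //= eqxx rmorph1 mul1r big1.
  by rewrite addr0 subrr; apply: ideal0.
by move=> j /negPf->; rewrite rmorph0 mul0r.
Qed.

(** The span is a module over the parameters, so stability under the whole ring need only be checked
    on variables times generators. *)
Lemma spanned_mull f x :
  (forall j i, spanned ('X_j * e i)) -> spanned x -> spanned (f * x).
Proof.
move=> We; elim/mpoly_ring_ind: f x => [c|f g IHf IHg|j f IHf] x Wx.
- exact: spanned_C.
- by rewrite mulrDl; apply: spannedD; [apply: IHf | apply: IHg].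
rewrite -mulrA; have [a Na] := IHf _ Wx.
rewrite -(subrK (\sum_i ev (a i) * e i) (f * x)).
rewrite mulrDr; apply: spannedD; first by apply/spanned_ideal; apply: ideal_mull.
rewrite mulr_sumr; apply: big_ind => [||i _]; last first.
- by rewrite mulrCA; apply: spanned_ev.
- by move=> u v; apply: spannedD.
- by apply: spanned_ideal; apply: ideal0.
Qed.

End Spanned.

(** * Binomial edge ideals *)

Section BinomialEdgeIdeal.
Context (K : fieldType) (n : nat).
Local Notation S := {mpoly K[n + n]}.
Local Notation x := (@xvar K n).
Local Notation y := (@yvar K n).
Implicit Types (G : sgraph 'I_n) (u v : 'I_n).

Definition minor u v : S := x u * y v - x v * y u.

Lemma minorC u v : minor v u = - minor u v.
Proof. by rewrite /minor; ring. Qed.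

Lemma minorxx u : minor u u = 0.
Proof. exact: subrr. Qed.

(** The expansion of a 3 by 3 determinant in which the row of the [x] is repeated. *)
Lemma plucker_x c u v : x c * minor u v = x u * minor c v - x v * minor c u.
Proof. by rewrite /minor; ring. Qed.

Lemma plucker_y c u v : y c * minor u v = y u * minor c v - y v * minor c u.
Proof. by rewrite /minor; ring. Qed.

Lemma ideal_bei G : ideal (@binomial_edge_ideal K n G).
Proof.
split.
- exists (fun _ _ => 0); rewrite big1 // => i _; rewrite big1 // => j _.
  by rewrite mul0r.
- move=> _ _ [c ->] [d ->]; exists (fun i j => c i j + d i j).
  rewrite -big_split /=; apply: eq_bigr => i _.
  by rewrite -big_split /=; apply: eq_bigr => j _; rewrite mulrDl.
- move=> a _ [c ->]; exists (fun i j => a * c i j).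
  rewrite scaler_sumr; apply: eq_bigr => i _.
  by rewrite scaler_sumr; apply: eq_bigr => j _; exact: mulrA.
Qed.

Lemma bei_minor G u v : adj G u v -> binomial_edge_ideal G (minor u v).
Proof.
wlog ltuv : u v / (u < v)%N => [IH adjuv|].
  have [/IH|ltvu|/val_inj eqij] := ltngtP u v; first exact.
    by rewrite minorC; apply: (idealN (ideal_bei G)); apply: IH; rewrite // adj_sym.
  by rewrite eqij adj_irr in adjuv.
move=> adjuv; exists (fun i j => ((i == u) && (j == v))%:R).
rewrite (bigD1 u) //= (bigD1 v) ?ltuv //= !eqxx mul1r.
rewrite [X in minor u v + X + _]big1 => [|j /andP[_ /negPf->]]; last by rewrite mul0r.
rewrite addr0 big1 ?addr0 // => i /negPf->.
by rewrite big1 // => j _; rewrite mul0r.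
Qed.

Lemma bei_sub G (I : S -> Prop) :
  ideal I -> (forall u v, adj G u v -> I (minor u v)) ->
  forall f, binomial_edge_ideal G f -> I f.
Proof.
move=> idI IG _ [c ->]; apply: ideal_sum => // u _.
by apply: ideal_sum => // v /andP[_ /IG]; apply: ideal_mull.
Qed.

Lemma minor_homog u v : minor u v \is 2.-homog.
Proof.
have xy (i j : 'I_(n + n)) : ('X_i * 'X_j : S) \is 2.-homog.
  by apply: (dhomogM (d := 1) (e := 1)); rewrite dhomogX /= mdeg1.
by rewrite /minor; apply: rpredB; apply: xy.
Qed.

(** The generators are homogeneous of degree 2, so splitting the coefficients into homogeneous parts
    splits the sum. *)
Lemma graded_bei G : graded_ideal (@binomial_edge_ideal K n G).
Proof.
split=> [|d _ [c ->]]; first exact: ideal_bei.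
have idG := ideal_bei G; rewrite raddf_sum; apply: ideal_sum => // u _.
rewrite raddf_sum; apply: ideal_sum => // v /andP[_ /bei_minor Gm].
rewrite /= -/(minor u v).
rewrite [X in pihomog _ _ (X * _)](pihomog_partitionE (leqnn (msize (c u v)))).
rewrite mulr_suml raddf_sum; apply: ideal_sum => // i _ /=.
have homm : pihomog mdeg i (c u v) * minor u v \is (i + 2).-homog.
  by apply: dhomogM; [apply: pihomogP | apply: minor_homog].
have [<-|ne] := eqVneq (i + 2)%N d.
  by rewrite (pihomog_dE homm); apply: ideal_mull.
by rewrite (pihomog_ne0 ne homm); apply: ideal0.
Qed.

(** The factor [w] depends on the vertex: a minor dies when its two vertices have the same [w], or
    when [t] vanishes at one of them. *)
Definition segre_img D (t w : 'I_n -> {mpoly K[D]}) (i : 'I_(n + n)) :=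
  match split i with inl v => t v | inr v => w v * t v end.

Lemma segre_img_x D (t w : 'I_n -> {mpoly K[D]}) v :
  msubst (segre_img t w) (x v) = t v.
Proof. by rewrite mmapXU /segre_img (unsplitK (inl v)). Qed.

Lemma segre_img_y D (t w : 'I_n -> {mpoly K[D]}) v :
  msubst (segre_img t w) (y v) = w v * t v.
Proof. by rewrite mmapXU /segre_img (unsplitK (inr v)). Qed.

Lemma segre_img_minor D (t w : 'I_n -> {mpoly K[D]}) u v :
  msubst (segre_img t w) (minor u v) = (w v - w u) * (t u * t v).
Proof.
by rewrite rmorphB !rmorphM /= !segre_img_x !segre_img_y; ring.
Qed.

Lemma irrelevant_x v : irrelevant_ideal (x v).
Proof. by rewrite /irrelevant_ideal mcoeffX mnm1_eq0. Qed.

Lemma irrelevant_y v : irrelevant_ideal (y v).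
Proof. by rewrite /irrelevant_ideal mcoeffX mnm1_eq0. Qed.

Lemma irrelevant_diag (a b : nat -> 'I_n) i :
  irrelevant_ideal (diag_seq (x \o a) (y \o b) i).
Proof.
case: i => [|i] /=; first exact: irrelevant_x.
by rewrite /irrelevant_ideal mcoeffB irrelevant_x irrelevant_y subrr.
Qed.

Lemma var_ind (P : S -> Prop) :
  (forall v, P (x v)) -> (forall v, P (y v)) -> forall i, P 'X_i.
Proof.
by move=> Px Py i; rewrite -(splitK i); case: (split i) => v; [apply: Px | apply: Py].
Qed.

(** Its binomial edge ideal is generated by all 2-minors of the generic 2 by [n] matrix. *)
Definition complete_graph : sgraph 'I_n.
Proof.
refine (@SGraph _ [set: 'I_n] (fun u v => u != v) _ _ _).
- by move=> u v; rewrite eq_sym.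
- by move=> u; rewrite eqxx.
- by move=> u v _; rewrite in_setT.
Defined.

End BinomialEdgeIdeal.

(** * The quotient of the ring by all 2-minors *)

Section CompleteGraph.
Context (K : fieldType) (n : nat) (v0 : 'I_n).
Local Notation S := {mpoly K[n + n]}.
Local Notation A := {mpoly K[n.+1]}.
Local Notation N := (@binomial_edge_ideal K n (complete_graph n)).

Let n_gt0 : (0 < n)%N. Proof. exact: leq_ltn_trans (ltn_ord v0). Qed.

Let vert i : 'I_n := insubd v0 i.
Let x i := xvar K (vert i).
Let y i := yvar K (vert i).
Let w : A := mvar K n.+1 n.
Let t i : A := tseq (mvar K n.+1) w i.
Let Phi := msubst (segre_img (fun v : 'I_n => t v) (fun=> w)).
(** The index [n] of the last parameter is that of [w], so that [Phi] maps [theta] to a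
    [last_subst]. *)
Let theta i := if i == n then y n.-1 else diag_seq x y i.
Let e (i : 'I_n) := if i : nat is j.+1 then y j else 1.

Let vertK i : (i < n)%N -> vert i = i :> nat.
Proof. by move=> ltin; rewrite insubdK. Qed.

Let Phi_x i : (i < n)%N -> Phi (x i) = t i.
Proof. by move=> ltin; rewrite [LHS]segre_img_x vertK. Qed.

Let Phi_y i : (i < n)%N -> Phi (y i) = w * t i.
Proof. by move=> ltin; rewrite [LHS]segre_img_y vertK. Qed.

Let Phi_theta i : (i < n.+1)%N -> Phi (theta i) = last_subst (w * t n.-1) i.
Proof.
rewrite ltnS leq_eqVlt /theta /last_subst; case: eqP => [_ _|_ /= ltin].
  by rewrite Phi_y //; lia.
rewrite [LHS](rmorph_diag_seq (msubst (segre_img _ _))) -[RHS](diag_tseq _ w).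
apply: eq_diag_seq => j leji; have ltjn := leq_ltn_trans leji ltin.
by split; [exact: Phi_x | exact: Phi_y].
Qed.

Let size_muni_t i : (i < n)%N -> size (muni (t i)) = i.+1.
Proof.
move=> ltin; rewrite /t /w muni_tseq muni_mvar eqxx.
rewrite (eq_tseq (T' := fun j => (mvar K n j)%:P)) ?size_tseq ?mvar_neq0 //.
by move=> j leji; rewrite /= muni_mvar ltn_eqF //; apply: leq_ltn_trans ltin.
Qed.

Let size_muni_wt i : (i < n)%N -> size (muni (w * t i)) = i.+2.
Proof.
move=> ltin; rewrite muniM /w muni_mvar eqxx mulrC size_mulX ?size_muni_t //.
by rewrite -size_poly_eq0 size_muni_t.
Qed.

Let W := @spanned K (n + n) n.+1 N 'I_n e theta.
Let idN := ideal_bei K (complete_graph n).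

Let W_last f : W f -> W (y n.-1 * f).
Proof.
have -> : y n.-1 = theta n by rewrite /theta eqxx.
exact: spanned_theta.
Qed.

Let W_diag i f : (i < n)%N -> W f -> W (diag_seq x y i * f).
Proof.
move=> ltin; have -> : diag_seq x y i = theta i by rewrite /theta ltn_eqF.
by apply: spanned_theta => //; apply: leqW.
Qed.

Let W1 : W 1.
Proof. exact: (spanned_gen _ idN _ _ (Ordinal n_gt0)). Qed.

Let W_y i : (i < n)%N -> W (y i).
Proof.
move=> ltin; have [ltSin|leni] := ltnP i.+1 n.
  exact: (spanned_gen _ idN _ _ (Ordinal ltSin)).
by have -> : i = n.-1 by [lia]; rewrite -[y _]mulr1; apply: W_last.
Qed.

Let W_x i : (i < n)%N -> W (x i).
Proof.
case: i => [|i] ltin; first by rewrite -[x _]mulr1; apply: (@W_diag 0).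
have -> : x i.+1 = diag_seq x y i.+1 * 1 + y i by rewrite /=; ring.
by apply: (spannedD idN); [apply: W_diag | apply: W_y; apply: ltnW].
Qed.

Let N_minor u v : N (minor K u v).
Proof.
have [<-|neuv] := eqVneq u v; last exact: bei_minor.
by rewrite minorxx; apply: ideal0.
Qed.

(** The walk with [tau = y]: its relations with [x] are minors, and those with [y] are trivial. *)
Let W_xy i a : (i < n)%N -> (a < n)%N -> W (x a * y i) /\ W (y a * y i).
Proof.
have WD := @spannedD _ _ n.+1 _ idN _ e theta.
have WN := @spannedN _ _ n.+1 _ idN _ e theta.
have Wmx j l : (j < n)%N -> (l < n)%N -> W (x j * y l - x l * y j).
  by move=> _ _; apply: spanned_ideal; apply: N_minor.
have Wmy j l : (j < n)%N -> (l < n)%N -> W (y j * y l - y l * y j).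
  by move=> _ _; rewrite mulrC subrr; apply: spanned_ideal => //; apply: ideal0.
move=> ltin ltan; split.
  exact: (span_mul_x WD WN W_diag W_last W_y Wmx Wmy).
exact: (span_mul_y WD WN W_diag W_last W_y Wmx Wmy).
Qed.

Lemma complete_graph_cohen_macaulay :
  cohen_macaulay_of_dim (fun _ : S => True) N n.+1.
Proof.
have vertE (v : 'I_n) : vert v = v by apply: val_inj; rewrite /= vertK.
apply: (@cohen_macaulay_of_free K (n + n) n.+1
  (segre_img (fun v : 'I_n => t v) (fun=> w)) _ N _ idN _ (Ordinal n_gt0) e theta)
  => //.
- apply: bei_sub => [|u v _]; last by rewrite segre_img_minor subrr mul0r.
  split; first by rewrite rmorph0.
    by move=> f g f0 g0; rewrite rmorphD /= f0 g0 addr0.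
  by move=> a f f0; rewrite [a *: f]/(a * f) rmorphM /= f0 mulr0.
- move=> f _; rewrite -[f]mulr1; apply: (spanned_mull idN) W1.
  apply: (@var_ind K n (fun z => forall i, W (z * e i))) => v i;
    rewrite -(vertE v) /e.
    case: i => -[|i] /= ltin; first by rewrite mulr1; apply: W_x.
    by have [] := W_xy (ltnW ltin) (ltn_ord v).
  case: i => -[|i] /= ltin; first by rewrite mulr1; apply: W_y.
  by have [] := W_xy (ltnW ltin) (ltn_ord v).
(* Freeness: the images of the basis have degrees [0, ..., n-1] in [w], and that of [y n.-1] has
   degree [n]. *)
- move=> a; rewrite rmorph_sum /= => sum0.
  have szF : size (muni (w * t n.-1)) = n.+1 by rewrite size_muni_wt; lia.
  have sze (i : 'I_n) : size (muni (Phi (e i))) = i.+1.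
    case: i => -[|i] ltin; first by rewrite [Phi _]rmorph1 muni1 size_poly1.
    by rewrite /e /= Phi_y ?size_muni_wt // ltnW.
  apply: (last_subst_indep szF sze); rewrite -[RHS]sum0; apply: eq_bigr => i _.
  rewrite rmorphM /= msubst_comp; congr (_ * _); apply: eq_msubst => l /=.
  by rewrite -Phi_theta.
- move=> i; rewrite ltnS => lein; rewrite /theta; case: eqP => _.
    exact: irrelevant_y.
  exact: irrelevant_diag.
(* Witnesses: [y 0], with image [w T_0], for the variable [w]; otherwise [x j], whose image becomes
   [T_j] once [w] is zero. *)
move=> j; rewrite ltnS leq_eqVlt => /predU1P[->|ltjn].
  exists (y 0%N); rewrite [msubst _ _]Phi_y // !rmorphM /= !kill_mvar leqnn mul0r.
  split=> //; rewrite ltnn leqn0 gtn_eqF //.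
  by apply/eqP; rewrite mulf_neq0 ?mvar_neq0.
exists (x j); rewrite [msubst _ _]Phi_x // !(rmorph_tseq (kill _)) /=.
rewrite !kill_mvar ltjn ltnW // !tseq0 /= !kill_mvar leqnn ltnn; split=> //.
by apply/eqP; rewrite mvar_neq0 // leqW.
Qed.

End CompleteGraph.

(** * The ideal of all 2-minors modulo the binomial edge ideal *)

Section TwoCliques.
Context (K : fieldType) (n : nat) (G : sgraph 'I_n) (A B : {set 'I_n}).
Context (a0 b0 : 'I_n) (Aa0 : a0 \in A) (Bb0 : b0 \in B).
Context (AB0 : [disjoint A & B]).
Context (adjE : forall u v, adj G u v = (u != v) &&
  ~~ ((u \in A) && (v \in B) || (u \in B) && (v \in A))).

Local Notation S := {mpoly K[n + n]}.
Context (p q : nat) (pE : #|A| = p) (qE : #|B| = q).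
Local Notation D := (p + q).+2.
Local Notation N := (@binomial_edge_ideal K n G).
Local Notation L := (@binomial_edge_ideal K n (complete_graph n)).
Local Notation T := (mvar K D).

Let p_gt0 : (0 < p)%N. Proof. by rewrite -pE; apply/card_gt0P; exists a0. Qed.
Let q_gt0 : (0 < q)%N. Proof. by rewrite -qE; apply/card_gt0P; exists b0. Qed.

Let va i := nth a0 (enum A) i.
Let vb i := nth b0 (enum B) i.
Let ia v := index v (enum A).
Let ib v := index v (enum B).

Let vaA i : (i < p)%N -> va i \in A.
Proof. by move=> ltip; rewrite -mem_enum mem_nth // -cardE ?pE ?qE. Qed.

Let vbB i : (i < q)%N -> vb i \in B.
Proof. by move=> ltiq; rewrite -mem_enum mem_nth // -cardE ?pE ?qE. Qed.

Let vaK i : (i < p)%N -> ia (va i) = i.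
Proof. by move=> ltip; rewrite [LHS]index_uniq ?enum_uniq -?cardE ?pE ?qE. Qed.

Let vbK i : (i < q)%N -> ib (vb i) = i.
Proof. by move=> ltiq; rewrite [LHS]index_uniq ?enum_uniq -?cardE ?pE ?qE. Qed.

Let iaK v : v \in A -> va (ia v) = v.
Proof. by move=> Av; rewrite [LHS]nth_index ?mem_enum. Qed.

Let ibK v : v \in B -> vb (ib v) = v.
Proof. by move=> Bv; rewrite [LHS]nth_index ?mem_enum. Qed.

Let ia_lt v : v \in A -> (ia v < p)%N.
Proof. by move=> Av; rewrite -pE cardE index_mem mem_enum. Qed.

Let ib_lt v : v \in B -> (ib v < q)%N.
Proof. by move=> Bv; rewrite -qE cardE index_mem mem_enum. Qed.

Let notBA v : v \in B -> (v \in A) = false.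
Proof. by move=> Bv; apply/negP => /(disjointFr AB0); rewrite Bv. Qed.

Let xa i := xvar K (va i).
Let ya i := yvar K (va i).
Let xb i := xvar K (vb i).
Let yb i := yvar K (vb i).

Let wa := T (p + q).
Let wb := T (p + q).+1.
Let ta i := tseq T wa i.
Let tb i := tseq (fun j => T (p + j)) wb i.
(** The value 0 is taken on the common part of the two cliques, so both variables of such a vertex
    go to 0. *)
Let t v := if v \in A then ta (ia v) else if v \in B then tb (ib v) else 0.
Let w v := if v \in A then wa else wb.
Let Phi := msubst (segre_img t w).

(** The parameters of [A] come first, then those of [B], and the two last [y] at the indices of [wa]
    and [wb]. *)
Let theta i :=
  if i == (p + q).+1 then yb q.-1 else if i == (p + q)%N then ya p.-1 else
  if (i < p)%N then diag_seq xa ya i else diag_seq xb yb (i - p).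

Let e (i : 'I_p * 'I_q) := minor K (va i.1) (vb i.2).

Let Phi_xa i : (i < p)%N -> Phi (xa i) = ta i.
Proof. by move=> lti; rewrite [LHS]segre_img_x /t vaA // vaK. Qed.

Let Phi_ya i : (i < p)%N -> Phi (ya i) = wa * ta i.
Proof. by move=> lti; rewrite [LHS]segre_img_y /t /w vaA // vaK. Qed.

Let Phi_xb i : (i < q)%N -> Phi (xb i) = tb i.
Proof. by move=> lti; rewrite [LHS]segre_img_x /t notBA vbB // vbK. Qed.

Let Phi_yb i : (i < q)%N -> Phi (yb i) = wb * tb i.
Proof. by move=> lti; rewrite [LHS]segre_img_y /t /w notBA vbB // vbK. Qed.

Let Phi_theta i : (i < D)%N ->
  Phi (theta i) = last2_subst (wa * ta p.-1) (wb * tb q.-1) i.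
Proof.
rewrite /theta /last2_subst => ltiD; case: eqP => [_|ni1].
  by rewrite Phi_yb //; lia.
case: eqP => [_|ni0]; first by rewrite Phi_ya //; lia.
case: ltnP => [ltip|lepi].
  rewrite [LHS](rmorph_diag_seq (msubst (segre_img _ _))) -[RHS](diag_tseq _ wa).
  apply: eq_diag_seq => j leji; have ltj := leq_ltn_trans leji ltip.
  by split; [exact: Phi_xa | exact: Phi_ya].
rewrite [LHS](rmorph_diag_seq (msubst (segre_img _ _))) -{2}(subnKC lepi).
rewrite -[RHS](diag_tseq (fun j => T (p + j)) wb).
apply: eq_diag_seq => j leji; have ltj : (j < q)%N by lia.
by split; [exact: Phi_xb | exact: Phi_yb].
Qed.

(** A copy of [ta] in the ring without [wb], where [wa] is the last variable. *)
Let ta1 i := tseq (mvar K (p + q).+1) (mvar K (p + q).+1 (p + q)) i.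

Let muni_wa : muni wa = (mvar K (p + q).+1 (p + q))%:P.
Proof. by rewrite muni_mvar ltn_eqF. Qed.

Let muni_wb : muni wb = 'X.
Proof. by rewrite muni_mvar eqxx. Qed.

Let muni_ta i : (i < p)%N -> muni (ta i) = (ta1 i)%:P.
Proof.
move=> ltip; rewrite /ta muni_tseq muni_wa.
rewrite (rmorph_tseq (@polyC _)); apply: eq_tseq => j leji /=.
by rewrite muni_mvar ltn_eqF //; lia.
Qed.

Let size_ta1 i : (i < p)%N -> size (muni (ta1 i)) = i.+1.
Proof.
move=> ltip; rewrite /ta1 muni_tseq muni_mvar eqxx.
rewrite (eq_tseq (T' := fun j => (mvar K (p + q) j)%:P)) ?size_tseq ?mvar_neq0 //.
  by lia.
by move=> j leji; rewrite /= muni_mvar ltn_eqF //; lia.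
Qed.

Let size_tb i : (i < q)%N -> size (muni (tb i)) = i.+1.
Proof.
move=> ltiq; rewrite /tb muni_tseq muni_wb.
rewrite (eq_tseq (T' := fun j => (mvar K (p + q).+1 (p + j))%:P)).
  by rewrite size_tseq // mvar_neq0 //; lia.
by move=> j leji; rewrite /= muni_mvar ltn_eqF //; lia.
Qed.

Let size_muni_mulX m (f : {mpoly K[m.+1]}) (g : {mpoly K[m.+1]}) d :
  muni g = 'X -> size (muni f) = d.+1 -> size (muni (g * f)) = d.+2.
Proof.
by move=> gX szf; rewrite muniM gX mulrC size_mulX ?szf // -size_poly_eq0 szf.
Qed.

Let W := @spanned K (n + n) D N _ e theta.
Let idN := ideal_bei K G.

Let WD f g : W f -> W g -> W (f + g). Proof. exact: spannedD. Qed.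
Let WN f : W f -> W (- f). Proof. exact: spannedN. Qed.
Let W_N f : N f -> W f. Proof. exact: spanned_ideal. Qed.

Let W_theta l f : (l < D)%N -> W f -> W (theta l * f).
Proof. exact: spanned_theta. Qed.

Let W_last_a f : W f -> W (ya p.-1 * f).
Proof.
have -> : ya p.-1 = theta (p + q) by rewrite /theta ltn_eqF // eqxx.
by apply: W_theta; lia.
Qed.

Let W_last_b f : W f -> W (yb q.-1 * f).
Proof.
have -> : yb q.-1 = theta (p + q).+1 by rewrite /theta eqxx.
by apply: W_theta; lia.
Qed.

Let W_diag_a i f : (i < p)%N -> W f -> W (diag_seq xa ya i * f).
Proof.
move=> ltip; have -> : diag_seq xa ya i = theta i.
  by rewrite /theta !ltn_eqF ?ltip //; lia.
by apply: W_theta; lia.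
Qed.

Let W_diag_b i f : (i < q)%N -> W f -> W (diag_seq xb yb i * f).
Proof.
move=> ltiq; have -> : diag_seq xb yb i = theta (p + i).
  by rewrite /theta !ltn_eqF ?addKn ?ltnNge ?leq_addr //; lia.
by apply: W_theta; lia.
Qed.

Let W_minor i j : (i < p)%N -> (j < q)%N -> W (minor K (va i) (vb j)).
Proof.
by move=> ltip ltjq; apply: (spanned_gen _ idN _ _ (Ordinal ltip, Ordinal ltjq)).
Qed.

Let N_minor u v : ~~ ((u \in A) && (v \in B) || (u \in B) && (v \in A)) ->
  N (minor K u v).
Proof.
have [<-|neuv] := eqVneq u v; first by rewrite minorxx => _; apply: ideal0.
by move=> notAB; apply: bei_minor; rewrite adjE neuv.
Qed.

Let N_minor_a i j : (i < p)%N -> (j < p)%N -> N (minor K (va i) (va j)).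
Proof.
move=> ltip ltjp; apply: N_minor.
by rewrite !(disjointFr AB0 (vaA _)) ?andbF.
Qed.

Let N_minor_b i j : (i < q)%N -> (j < q)%N -> N (minor K (vb i) (vb j)).
Proof.
by move=> ltiq ltjq; apply: N_minor; rewrite !(notBA (vbB _)) ?andbF.
Qed.

(** The walk along [A] with the minors [[a_m b_l]], [l] fixed, as [tau]: by the Plücker relations
    the required differences are multiples of minors inside the clique [A]. *)
Let W_mul_a i j l : (i < p)%N -> (j < p)%N -> (l < q)%N ->
  W (xa i * minor K (va j) (vb l)) /\ W (ya i * minor K (va j) (vb l)).
Proof.
move=> ltip ltjp ltlq.
have W_tau m : (m < p)%N -> W (minor K (va m) (vb l)).
  by move=> ltmp; apply: W_minor.
have Wx a b : (a < p)%N -> (b < p)%N ->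
    W (xa a * minor K (va b) (vb l) - xa b * minor K (va a) (vb l)).
  move=> lta ltb; have -> : xa a * minor K (va b) (vb l) - xa b * minor K (va a) (vb l)
      = - xb l * minor K (va a) (va b) by rewrite /minor /xa /xb; ring.
  by apply: W_N; apply: ideal_mull => //; apply: N_minor_a.
have Wy a b : (a < p)%N -> (b < p)%N ->
    W (ya a * minor K (va b) (vb l) - ya b * minor K (va a) (vb l)).
  move=> lta ltb; have -> : ya a * minor K (va b) (vb l) - ya b * minor K (va a) (vb l)
      = - yb l * minor K (va a) (va b) by rewrite /minor /ya /yb; ring.
  by apply: W_N; apply: ideal_mull => //; apply: N_minor_a.
split.
  exact: (span_mul_x WD WN W_diag_a W_last_a W_tau Wx Wy).
exact: (span_mul_y WD WN W_diag_a W_last_a W_tau Wx Wy).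
Qed.

Let W_mul_b i j l : (i < q)%N -> (j < p)%N -> (l < q)%N ->
  W (xb i * minor K (va j) (vb l)) /\ W (yb i * minor K (va j) (vb l)).
Proof.
move=> ltiq ltjp ltlq.
have W_tau m : (m < q)%N -> W (minor K (va j) (vb m)).
  by move=> ltmq; apply: W_minor.
have Wx a b : (a < q)%N -> (b < q)%N ->
    W (xb a * minor K (va j) (vb b) - xb b * minor K (va j) (vb a)).
  move=> lta ltb; have -> : xb a * minor K (va j) (vb b) - xb b * minor K (va j) (vb a)
      = xa j * minor K (vb a) (vb b) by rewrite /minor /xa /xb; ring.
  by apply: W_N; apply: ideal_mull => //; apply: N_minor_b.
have Wy a b : (a < q)%N -> (b < q)%N ->
    W (yb a * minor K (va j) (vb b) - yb b * minor K (va j) (vb a)).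
  move=> lta ltb; have -> : yb a * minor K (va j) (vb b) - yb b * minor K (va j) (vb a)
      = ya j * minor K (vb a) (vb b) by rewrite /minor /ya /yb; ring.
  by apply: W_N; apply: ideal_mull => //; apply: N_minor_b.
split.
  exact: (span_mul_x WD WN W_diag_b W_last_b W_tau Wx Wy).
exact: (span_mul_y WD WN W_diag_b W_last_b W_tau Wx Wy).
Qed.

(** A vertex outside [A] and [B] is adjacent to all others, so the minors on the right of the
    Plücker relations lie in [N]. *)
Let N_mul_c c u v : c \notin A -> c \notin B ->
  N (xvar K c * minor K u v) /\ N (yvar K c * minor K u v).
Proof.
move=> /negPf nAc /negPf nBc; rewrite plucker_x plucker_y.
have Nc z : N (minor K c z) by apply: N_minor; rewrite nAc nBc.
by split; apply: idealB => //; apply: ideal_mull.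
Qed.

Let W_mul_var v i : W (xvar K v * e i) /\ W (yvar K v * e i).
Proof.
have [Av|nAv] := boolP (v \in A).
  by rewrite -(iaK Av); apply: W_mul_a; rewrite ?ia_lt.
have [Bv|nBv] := boolP (v \in B).
  by rewrite -(ibK Bv); apply: W_mul_b; rewrite ?ib_lt.
by have [Nx Ny] := N_mul_c (va i.1) (vb i.2) nAv nBv; split; apply: W_N.
Qed.

Let W_mull f g : W g -> W (f * g).
Proof.
apply: (spanned_mull idN).
apply: (@var_ind K n (fun z => forall i, W (z * e i))) => v i.
  by have [] := W_mul_var v i.
by have [] := W_mul_var v i.
Qed.

Let L_span f : L f -> W f.
Proof.
apply: bei_sub => [|u v _].
  split; [by apply: W_N; apply: ideal0 | exact: WD | exact: W_mull].
have W_ab u' v' : u' \in A -> v' \in B -> W (minor K u' v').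
  by move=> Au Bv; rewrite -(iaK Au) -(ibK Bv); apply: W_minor; rewrite ?ia_lt ?ib_lt.
case AB: ((u \in A) && (v \in B) || (u \in B) && (v \in A)); last first.
  by apply/W_N/N_minor; rewrite AB.
case/orP: AB => /andP[Xu Yv]; first exact: W_ab.
by rewrite minorC; apply: WN; apply: W_ab.
Qed.

(** An edge either joins vertices with equal [w], or joins [A] to a vertex where [t] is zero. *)
Let Phi_N f : N f -> Phi f = 0.
Proof.
apply: (bei_sub (I := fun f => Phi f = 0)) => [|u v].
  split; first exact: rmorph0.
    by move=> g g' g0 g0'; rewrite [LHS]rmorphD [X in X + _]g0 [X in _ + X]g0' addr0.
  by move=> a g g0; rewrite [LHS]rmorphM [X in _ * X]g0 mulr0.
rewrite adjE [Phi _]segre_img_minor /t /w => /andP[_].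
have [Au|nAu] := boolP (u \in A); have [Av|nAv] := boolP (v \in A) => /=.
- by rewrite subrr mul0r.
- by rewrite andbF orbF => /negPf->; rewrite !mulr0.
- by rewrite andbT => /negPf->; rewrite mul0r mulr0.
- by rewrite subrr mul0r.
Qed.

Lemma two_cliques_cohen_macaulay : cohen_macaulay_of_dim L N D.
Proof.
apply: (@cohen_macaulay_of_free K (n + n) D (segre_img t w) L N _ idN _
  (Ordinal p_gt0, Ordinal q_gt0) e theta) => //.
- exact: ideal_bei.
- move=> [i j]; apply: bei_minor; apply/eqP => /= eq_ab.
  by have := vaA (ltn_ord i); rewrite eq_ab notBA // vbB.
- move=> a; rewrite rmorph_sum /= => sum0.
  have szFA : size (muni (mvar K (p + q).+1 (p + q) * ta1 p.-1)) = p.+1.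
    rewrite (size_muni_mulX (d := p.-1)) ?muni_mvar ?eqxx // ?size_ta1; lia.
  have szeA (i : 'I_p) : size (muni (ta1 i)) = i.+1 by apply: size_ta1.
  have muniFA' : muni (wa * ta p.-1) = (mvar K (p + q).+1 (p + q) * ta1 p.-1)%:P.
    by rewrite muniM muni_wa muni_ta ?polyCM //; lia.
  have muni_eA' (i : 'I_p) : muni (ta i) = (ta1 i)%:P by apply: muni_ta.
  have szFB : size (muni (wb * tb q.-1)) = q.+1.
    rewrite (size_muni_mulX (d := q.-1)) // ?size_tb; lia.
  have szeB (i : 'I_q) : size (muni (tb i)) = i.+1 by apply: size_tb.
  apply: (last2_subst_indep szFA szeA muniFA' muni_eA' szFB szeB).
  (* The images of the basis minors share the factor [wb - wa]; cancelling it leaves the products of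
     [ta] and [tb]. *)
  have w_neq : wb - wa != 0.
    apply: contraTneq isT => /(congr1 (@muni _ K)).
    rewrite muniB muni_wa muni_wb muni0 => /(congr1 (fun f : {poly _} => size f)).
    by rewrite size_XsubC size_poly0.
  apply: (mulfI w_neq); rewrite mulr0 -[RHS]sum0 mulr_sumr; apply: eq_bigr => i _.
  rewrite rmorphM /= msubst_comp /e segre_img_minor /t /w vaA // !notBA ?vbB //.
  rewrite vaK // vbK // mulrCA; congr (_ * _); apply: eq_msubst => l /=.
  by rewrite -Phi_theta.
- move=> i _; rewrite /theta; case: eqP => _; first exact: irrelevant_y.
  case: eqP => _; first exact: irrelevant_y.
  by case: ltnP => _; apply: irrelevant_diag.
(* Witnesses: [ya 0] and [yb 0] for [wa] and [wb]; otherwise the variable [xa] or [xb] whose image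
   becomes [T_j] once [wa] and [wb] are zero. *)
move=> j ltjD; have [ltjN|] := ltnP j (p + q); last first.
  rewrite leq_eqVlt => /predU1P[<-|ltj].
    exists (ya 0%N); rewrite [msubst _ _]Phi_ya // !rmorphM /= !kill_mvar leqnn mul0r.
    split=> //; rewrite ltnn leqn0 gtn_eqF; last by lia.
    by apply/eqP; rewrite mulf_neq0 ?mvar_neq0.
  have -> : j = (p + q).+1 by lia.
  exists (yb 0%N); rewrite [msubst _ _]Phi_yb // !rmorphM /= !kill_mvar leqnn mul0r.
  split=> //; rewrite ltnn addn0 leqNgt ltnS leqW ?leq_addr //=.
  by apply/eqP; rewrite mulf_neq0 ?mvar_neq0 //; lia.
have [ltjp|lepj] := ltnP j p.
  exists (xa j); rewrite [msubst _ _]Phi_xa // !(rmorph_tseq (kill _)) /=.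
  rewrite !kill_mvar ltjN ltnW // !tseq0 /= !kill_mvar leqnn ltnn; split=> //.
  by apply/eqP; rewrite mvar_neq0.
have ltjq : (j - p < q)%N by lia.
exists (xb (j - p)); rewrite [msubst _ _]Phi_xb // !(rmorph_tseq (kill _)) /=.
rewrite !kill_mvar ltnS !(ltnW ltjN) leqW ?(ltnW ltjN) //.
rewrite !tseq0 /= !kill_mvar subnKC // leqnn ltnn; split=> //.
by apply/eqP; rewrite mvar_neq0.
Qed.

End TwoCliques.

(** * Graphs with two facets *)

Section Graphs.
Context (T : finType).
Implicit Types (G : sgraph T) (F : {set T}).

Lemma cliqueP G F :
  reflect (F \subset vset G /\ {in F &, forall u v, u != v -> adj G u v}) (clique G F).
Proof.
apply: (iffP andP) => -[sF adjF]; split=> //.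
  move=> u v Fu Fv; move/forallP/(_ u): adjF; rewrite Fu /= => /forallP/(_ v).
  by rewrite Fv /= => /implyP; apply.
apply/forall_inP => u Fu; apply/forall_inP => v Fv; apply/implyP; exact: adjF.
Qed.

(** Taken on the two facets, these are the parts of a decomposition of [G]. *)
Definition clique_graph F : sgraph T.
Proof.
refine (@SGraph _ F (fun u v => [&& u \in F, v \in F & u != v]) _ _ _).
- by move=> u v; rewrite eq_sym; case: (u \in F); case: (v \in F).
- by move=> u; rewrite eqxx !andbF.
- by move=> u v /andP[].
Defined.

Lemma facets_clique_graph F : facets (clique_graph F) = [set F].
Proof.
have cliqueF X : clique (clique_graph F) X = (X \subset F).
  apply/cliqueP/idP => [[]//|sXF]; split=> // u v Xu Xv neuv.
  by rewrite /= !(subsetP sXF).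
apply/setP => X; rewrite !inE; apply/maxsetP/eqP => [[]|->].
  by rewrite cliqueF => sXF /(_ F); rewrite cliqueF => ->.
by split=> [|Y]; rewrite cliqueF // => sYF sFY; apply/eqP; rewrite eqEsubset sYF.
Qed.

Lemma free_vertex_clique_graph F v : v \in F -> free_vertex (clique_graph F) v.
Proof.
move=> Fv; rewrite /free_vertex facets_clique_graph.
rewrite (_ : [set _ in _ | _] = [set F]) ?cards1 //.
by apply/setP => X; rewrite !inE; case: eqP => // ->.
Qed.

Section TwoFacets.
Context (G : sgraph T) (F1 F2 : {set T}).
Context (G_vertices : vset G = [set: T]) (F1_neq_F2 : F1 != F2).
Context (G_facets : facets G = [set F1; F2]).

Let facetP F : F \in facets G -> maxset (clique G) F.
Proof. by rewrite inE. Qed.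

Lemma clique_facet F : F \in facets G -> {in F &, forall u v, u != v -> adj G u v}.
Proof. by move/facetP/maxsetp/cliqueP => []. Qed.

Lemma clique_sub_facet F : clique G F -> (F \subset F1) || (F \subset F2).
Proof.
move=> /maxset_exists[F' maxF' sFF'].
have : F' \in facets G by rewrite inE.
by rewrite G_facets !inE => /orP[] /eqP <-; rewrite sFF' ?orbT.
Qed.

Lemma facet_proper : ~~ (F1 \subset F2) /\ ~~ (F2 \subset F1).
Proof.
have max1 : maxset (clique G) F1 by apply: facetP; rewrite G_facets set21.
have max2 : maxset (clique G) F2 by apply: facetP; rewrite G_facets set22.
split; apply: contra F1_neq_F2.
  by move/(maxsetsup max1 (maxsetp max2)) ->.
by move/(maxsetsup max2 (maxsetp max1)) ->.
Qed.

Lemma cover_facets : F1 :|: F2 = [set: T].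
Proof.
apply/setP => v; rewrite !inE -!sub1set; apply: clique_sub_facet.
apply/cliqueP; rewrite G_vertices subsetT; split=> // a b /set1P -> /set1P ->.
by rewrite eqxx.
Qed.

Lemma adj_facets u v :
  adj G u v = (u != v) && ((u \in F1) && (v \in F1) || (u \in F2) && (v \in F2)).
Proof.
apply/idP/andP => [adjuv|[neuv /orP[]/andP[Fu Fv]]]; last 2 first.
- by apply: (clique_facet (F := F1)); rewrite // G_facets set21.
- by apply: (clique_facet (F := F2)); rewrite // G_facets set22.
split; first by apply: contraTneq adjuv => ->; rewrite adj_irr.
have : clique G [set u; v].
  apply/cliqueP; rewrite G_vertices subsetT; split=> // a b.
  move=> /set2P[]-> /set2P[]->; rewrite ?eqxx // => _ //.
  by rewrite adj_sym.
by move/clique_sub_facet; rewrite !subUset !sub1set.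
Qed.

(** If the facets were disjoint, [F1] would be closed under adjacency and [G] disconnected. If they
    met in one vertex, [G] would decompose there into two complete graphs, in which every vertex is
    free. *)
Lemma indecomposable_card_facets :
  indecomposable G -> (1 < #|F1 :&: F2|)%N.
Proof.
move=> [conG indecG]; rewrite ltnNge; apply/negP => le1.
have [/subsetPn[a F1a nF2a] /subsetPn[b F2b nF1b]] := facet_proper.
have [C0|[v F12v]] := set_0Vmem (F1 :&: F2).
  have closedF1 : closed (adj G) F1.
    move=> x y; rewrite adj_facets => /andP[_].
    have notF2 z : z \in F2 -> (z \in F1) = false.
      by move=> F2z; move/setP/(_ z): C0; rewrite !inE F2z andbT.
    by case/orP=> /andP[] => [->-> //|/notF2-> /notF2->].
  have /(closed_connect closedF1) : connect (adj G) a b.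
    by apply: conG; rewrite G_vertices.
  by rewrite F1a (negPf nF1b).
have F12E : F1 :&: F2 = [set v].
  apply/esym/eqP; rewrite eqEcard sub1set F12v cards1 //.
have [F1v F2v] := setIP F12v.
have card_gt1 (F : {set T}) c : c \in F -> v \in F -> c != v -> (1 < #|F|)%N.
  move=> Fc Fv necv; apply: (@leq_trans #|[set c; v]|); first by rewrite cards2 necv.
  by apply: subset_leq_card; rewrite subUset !sub1set Fc.
apply: indecG; split=> //; exists (clique_graph F1), (clique_graph F2), v; split.
- split; first by apply: (card_gt1 _ a) => //; apply: contraNneq nF2a => ->.
  by apply: (card_gt1 _ b) => //; apply: contraNneq nF1b => ->.
- by rewrite G_vertices cover_facets.
- move=> x y; rewrite adj_facets /=; case: eqP => _; first by rewrite !andbF.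
  by rewrite /= !andbT.
- exact: F12E.
- by split; apply: free_vertex_clique_graph.
Qed.

End TwoFacets.
End Graphs.

(** * The two-step filtration *)

Theorem proposition2p1 (K : fieldType) (n : nat) (G : sgraph 'I_n)
    (G_vertices : vset G = [set: 'I_n])
    (G_indec : indecomposable G) (G_closed : closed_graph G)
    (F1 F2 : {set 'I_n}) (F1_neq_F2 : F1 != F2)
    (G_facets : facets G = [set F1; F2]) :
  sequentially_cohen_macaulay (@binomial_edge_ideal K n G).
Proof.
have [/subsetPn[a F1a nF2a] /subsetPn[b F2b nF1b]] := facet_proper F1_neq_F2 G_facets.
have coverF := cover_facets G_vertices G_facets.
have adjE := adj_facets G_vertices G_facets.
have card12 := indecomposable_card_facets G_vertices F1_neq_F2 G_facets G_indec.
(* The facets cover all [n] vertices and share at least two, which makes the dimensions strictly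
   increase. *)
have dims : ((#|F1 :\: F2| + #|F2 :\: F1|).+2 < n.+1)%N.
  have := cardsUI F1 F2; rewrite coverF cardsT card_ord.
  have := cardsID F2 F1; have := cardsID F1 F2; rewrite [F2 :&: F1]setIC.
  move: #|F1 :&: F2| #|F1 :\: F2| #|F2 :\: F1| #|F1| #|F2| card12 => c p q f1 f2.
  lia.
pose J := @binomial_edge_ideal K n G.
pose J' := @binomial_edge_ideal K n (complete_graph n).
have JJ' f : J f -> J' f.
  apply: bei_sub => [|u v]; first exact: ideal_bei.
  by rewrite adjE => /andP[neuv _]; apply: bei_minor.
exists 2%N, (fun i => if i is i'.+1 then if i' is 0 then J' else fun=> True else J).
exists (fun i => if i is 0 then (#|F1 :\: F2| + #|F2 :\: F1|).+2 else n.+1).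
split=> //.
- by case=> [|[|[|//]]] _; [exact: graded_bei | exact: graded_bei | split].
- by case=> [|[|//]] _.
- case=> [|[|//]] _; last exact: complete_graph_cohen_macaulay.
  apply: (@two_cliques_cohen_macaulay K n G (F1 :\: F2) (F2 :\: F1) a b) => //.
  + by rewrite inE nF2a.
  + by rewrite inE nF1b.
  + by rewrite -setI_eq0; apply/eqP/setP => v; rewrite !inE; do 2!case: (v \in _).
  (* Since the facets cover all vertices, two vertices lie in no common facet exactly when each
     difference contains one of them. *)
  + move=> u v; rewrite adjE; congr (_ && _).
    have := in_setT u; have := in_setT v; rewrite -coverF !inE.
    by do 4!case: (_ \in _).
- by case.
Qed.
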